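(* Let $P$ be an arbitrary set, let $\mathcal{L}_c\mathcal{S}$ be the category of the symmetric monoidal monad (with $\psi^L$ and $\psi^R$ primitive) freely generated by $P$ as set of generating objects, and let $\mathit{Fun}$ be the category of all functions between finite ordinals. Then the functor $G:\mathcal{L}_c\mathcal{S}\to\mathit{Fun}$ defined in the context is faithful; i.e. for all objects $A,B$ and all arrows $f,g:A\to B$ of $\mathcal{L}_c\mathcal{S}$, if $Gf=Gg$, then $f=g$.
   Context: A symmetric monoidal category has a bifunctor $\otimes$, a unit object $I$ and natural isomorphisms $a_{A,B,C}:(A\otimes B)\otimes C\to A\otimes(B\otimes C)$, $l_A:I\otimes A\to A$, $r_A:A\otimes I\to A$, $c_{A,B}:A\otimes B\to B\otimes A$ satisfying the usual coherence conditions (with $c_{B,A}\circ c_{A,B}=\mathbf 1_{A\otimes B}$). $\mathbf 1_A$ denotes the identity arrow of $A$. A symmetric monoidal monad in a symmetric monoidal category is a monad $\langle T,\eta,\mu\rangle$ (with $\eta_A:A\to TA$, $\mu_A:TTA\to TA$) together with natural transformations with components $\psi^L_{A,B}:TA\otimes B\to T(A\otimes B)$ and $\psi^R_{A,B}:A\otimes TB\to T(A\otimes B)$ such that - $Ta_{A,B,C}\circ\psi^L_{A\otimes B,C}\circ(\psi^L_{A,B}\otimes\mathbf 1_C)=\psi^L_{A,B\otimes C}\circ a_{TA,B,C}$, - $Tr_A\circ\psi^L_{A,I}=r_{TA}$, - $Ta_{A,B,C}\circ\psi^R_{A\otimes B,C}=\psi^R_{A,B\otimes C}\circ(\mathbf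 1_A\otimes\psi^R_{B,C})\circ a_{A,B,TC}$, - $Tl_A\circ\psi^R_{I,A}=l_{TA}$, - $Ta_{A,B,C}\circ\psi^L_{A\otimes B,C}\circ(\psi^R_{A,B}\otimes\mathbf 1_C)=\psi^R_{A,B\otimes C}\circ(\mathbf 1_A\otimes\psi^L_{B,C})\circ a_{A,TB,C}$, - $\psi^L_{A,B}\circ(\eta_A\otimes\mathbf 1_B)=\eta_{A\otimes B}$ and $\psi^R_{A,B}\circ(\mathbf 1_A\otimes\eta_B)=\eta_{A\otimes B}$, - $\psi^L_{A,B}\circ(\mu_A\otimes\mathbf 1_B)=\mu_{A\otimes B}\circ T\psi^L_{A,B}\circ\psi^L_{TA,B}$, - $\psi^R_{A,B}\circ(\mathbf 1_A\otimes\mu_B)=\mu_{A\otimes B}\circ T\psi^R_{A,B}\circ\psi^R_{A,TB}$, - $\mu_{A\otimes B}\circ T\psi^L_{A,B}\circ\psi^R_{TA,B}=\mu_{A\otimes B}\circ T\psi^R_{A,B}\circ\psi^L_{A,TB}:TA\otimes TB\to T(A\otimes B)$, - $Tc_{A,B}\circ\psi^L_{A,B}=\psi^R_{B,A}\circ c_{TA,B}$. $\mathcal{L}_c\mathcal{S}$ is the free such structure on $P$: its objects are the formal expressions built from elements of $P$ (propositional letters) and $I$ by $\otimes$ and $T$; its arrows are arrow terms built from identities, $a,a^{-1},l,l^{-1},r,r^{-1},c,\eta,\mu,\psi^L,\psi^R$ by $\circ$, $\otimes$ and $T$, modulo the congruence generated by the equations of categories, functoriality, naturality, symmetric monoidal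 categories, monads, and the equations above. $\mathit{Fun}$ has as objects the finite ordinals $n=\{0,\dots,n-1\}$ and as arrows arbitrary functions between them. The functor $G$: $GA$ is the number of occurrences of propositional letters in $A$ plus the number of occurrences of $T$ in $A$ (occurrences of $I$ are not counted); the elements $0,\dots,GA-1$ of $GA$ correspond to these occurrences counted from right to left in $A$. On arrow terms: $G$ of an identity, of $a_{A,B,C}$, $l_A$, $r_A$ and their inverses, and of $\psi^L_{A,B}$ is the identity function; $G\psi^R_{A,B}$ is the bijection that sends the occurrence of $T$ immediately in front of $B$ in the source $A\otimes TB$ to the outermost (leftmost) occurrence of $T$ in the target $T(A\otimes B)$, and sends every counted occurrence inside $A$, respectively inside $B$, to the corresponding occurrence inside $A$, respectively $B$; $Gc_{A,B}$ is the bijection sending every occurrence in $A$, respectively $B$, in the source $A\otimes B$ to the corresponding occurrence in $A$, respectively $B$, in the target $B\otimes A$; $G\eta_A:GA\to GA+1$ is $i\mapsto i$; $G\mu_A:GA+2\to GA+1$ is $i\mapsto i$ for $i\le GA$ and $GA+1\mapsto GA$; $G(f\otimes g)$ is the juxtaposition of $Gf$ (on the left, i.e. on the larger elements) and $Gg$ (on the right, i.e. on the smaller elements); $GTf$ extends $Gf$ by sending the new leftmost (greatest) element of the source to the new leftmost (greatest) element of the target; $G(g\circ f)=Gg\circ Gf$. *)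

(* Defs.v *)
From mathcomp Require Import all_boot.
From mathcomp Require Import zify.

Set Implicit Arguments.
Unset Strict Implicit.
Unset Printing Implicit Defensive.

(* Categories are taken with hom-setoids: [eqhom] is the equality of arrows. *)
Record category := Category {
  ob :> Type;
  hom : ob -> ob -> Type;
  eqhom : forall a b, hom a b -> hom a b -> Prop;
  idhom : forall a, hom a a;
  comphom : forall a b c, hom b c -> hom a b -> hom a c;
  eqhom_refl : forall a b (f : hom a b), eqhom f f;
  eqhom_sym : forall a b (f g : hom a b), eqhom f g -> eqhom g f;
  eqhom_trans : forall a b (f g h : hom a b),
    eqhom f g -> eqhom g h -> eqhom f h;
  comphom_eq : forall a b c (g g' : hom b c) (f f' : hom a b),
    eqhom g g' -> eqhom f f' -> eqhom (comphom g f) (comphom g' f');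
  comp_idl : forall a b (f : hom a b), eqhom (comphom (idhom b) f) f;
  comp_idr : forall a b (f : hom a b), eqhom (comphom f (idhom a)) f;
  comp_assoc : forall a b c d (h : hom c d) (g : hom b c) (f : hom a b),
    eqhom (comphom (comphom h g) f) (comphom h (comphom g f))
}.

Record functor (C D : category) := Functor {
  fob : C -> D;
  fmap : forall a b : C, hom a b -> hom (fob a) (fob b);
  fmap_eq : forall (a b : C) (f g : hom a b),
    eqhom f g -> eqhom (fmap f) (fmap g);
  fmap_id : forall a : C, eqhom (fmap (idhom a)) (idhom (fob a));
  fmap_comp : forall (a b c : C) (g : hom b c) (f : hom a b),
    eqhom (fmap (comphom g f)) (comphom (fmap g) (fmap f))
}.

Definition faithful (C D : category) (F : functor C D) : Prop :=
  forall (a b : C) (f g : hom a b), eqhom (fmap F f) (fmap F g) -> eqhom f g.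

Inductive obj (P : Type) : Type :=
  | Letter of P
  | Unit
  | Tens of obj P & obj P
  | T of obj P.

Arguments Unit {P}.

Declare Scope lc_scope.
Delimit Scope lc_scope with lc.
Local Open Scope lc_scope.

Notation "A ⊗ B" := (Tens A B) (at level 40, left associativity) : lc_scope.

Inductive arr (P : Type) : obj P -> obj P -> Type :=
  | Id A : arr A A
  | Comp A B C : arr B C -> arr A B -> arr A C
  | TensArr A A' B B' : arr A A' -> arr B B' -> arr (A ⊗ B) (A' ⊗ B')
  | T₁ A B : arr A B -> arr (T A) (T B)
  | Assoc A B C : arr ((A ⊗ B) ⊗ C) (A ⊗ (B ⊗ C))
  | AssocInv A B C : arr (A ⊗ (B ⊗ C)) ((A ⊗ B) ⊗ C)
  | LUnit A : arr (Unit ⊗ A) A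
  | LUnitInv A : arr A (Unit ⊗ A)
  | RUnit A : arr (A ⊗ Unit) A
  | RUnitInv A : arr A (A ⊗ Unit)
  | Braid A B : arr (A ⊗ B) (B ⊗ A)
  | η A : arr A (T A)
  | μ A : arr (T (T A)) (T A)
  | ψL A B : arr (T A ⊗ B) (T (A ⊗ B))
  | ψR A B : arr (A ⊗ T B) (T (A ⊗ B)).

Notation "g ∘ f" := (Comp g f) (at level 50, left associativity) : lc_scope.
Notation "f ⊗₁ g" := (TensArr f g) (at level 40, left associativity) : lc_scope.

Reserved Notation "f ≈ g" (at level 70, no associativity).

Inductive eqarr (P : Type) : forall A B : obj P, arr A B -> arr A B -> Prop :=
  | eqarr_refl A B (f : arr A B) : f ≈ f
  | eqarr_sym A B (f g : arr A B) : f ≈ g -> g ≈ f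
  | eqarr_trans A B (f g h : arr A B) : f ≈ g -> g ≈ h -> f ≈ h
  | eqarr_comp A B C (g g' : arr B C) (f f' : arr A B) :
      g ≈ g' -> f ≈ f' -> g ∘ f ≈ g' ∘ f'
  | eqarr_tens A A' B B' (f f' : arr A A') (g g' : arr B B') :
      f ≈ f' -> g ≈ g' -> f ⊗₁ g ≈ f' ⊗₁ g'
  | eqarr_T A B (f f' : arr A B) : f ≈ f' -> T₁ f ≈ T₁ f'
  | cat_idl A B (f : arr A B) : Id B ∘ f ≈ f
  | cat_idr A B (f : arr A B) : f ∘ Id A ≈ f
  | cat_assoc A B C D (h : arr C D) (g : arr B C) (f : arr A B) :
      (h ∘ g) ∘ f ≈ h ∘ (g ∘ f)
  | tens_id A B : Id A ⊗₁ Id B ≈ Id (A ⊗ B)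
  | tens_comp A A' A'' B B' B'' (f' : arr A' A'') (f : arr A A')
      (g' : arr B' B'') (g : arr B B') :
      (f' ∘ f) ⊗₁ (g' ∘ g) ≈ (f' ⊗₁ g') ∘ (f ⊗₁ g)
  | T_id A : T₁ (Id A) ≈ Id (T A)
  | T_comp A B C (g : arr B C) (f : arr A B) : T₁ (g ∘ f) ≈ T₁ g ∘ T₁ f
  | assoc_nat A A' B B' C C' (f : arr A A') (g : arr B B') (h : arr C C') :
      Assoc A' B' C' ∘ ((f ⊗₁ g) ⊗₁ h) ≈ (f ⊗₁ (g ⊗₁ h)) ∘ Assoc A B C
  | lunit_nat A A' (f : arr A A') : LUnit A' ∘ (Id Unit ⊗₁ f) ≈ f ∘ LUnit A
  | runit_nat A A' (f : arr A A') : RUnit A' ∘ (f ⊗₁ Id Unit) ≈ f ∘ RUnit A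
  | braid_nat A A' B B' (f : arr A A') (g : arr B B') :
      Braid A' B' ∘ (f ⊗₁ g) ≈ (g ⊗₁ f) ∘ Braid A B
  | eta_nat A A' (f : arr A A') : η A' ∘ f ≈ T₁ f ∘ η A
  | mu_nat A A' (f : arr A A') : μ A' ∘ T₁ (T₁ f) ≈ T₁ f ∘ μ A
  | psiL_nat A A' B B' (f : arr A A') (g : arr B B') :
      ψL A' B' ∘ (T₁ f ⊗₁ g) ≈ T₁ (f ⊗₁ g) ∘ ψL A B
  | psiR_nat A A' B B' (f : arr A A') (g : arr B B') :
      ψR A' B' ∘ (f ⊗₁ T₁ g) ≈ T₁ (f ⊗₁ g) ∘ ψR A B
  | assoc_invl A B C : AssocInv A B C ∘ Assoc A B C ≈ Id ((A ⊗ B) ⊗ C)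
  | assoc_invr A B C : Assoc A B C ∘ AssocInv A B C ≈ Id (A ⊗ (B ⊗ C))
  | lunit_invl A : LUnitInv A ∘ LUnit A ≈ Id (Unit ⊗ A)
  | lunit_invr A : LUnit A ∘ LUnitInv A ≈ Id A
  | runit_invl A : RUnitInv A ∘ RUnit A ≈ Id (A ⊗ Unit)
  | runit_invr A : RUnit A ∘ RUnitInv A ≈ Id A
  | braid_inv A B : Braid B A ∘ Braid A B ≈ Id (A ⊗ B)
  | pentagon A B C D :
      Assoc A B (C ⊗ D) ∘ Assoc (A ⊗ B) C D
      ≈ (Id A ⊗₁ Assoc B C D) ∘ Assoc A (B ⊗ C) D ∘ (Assoc A B C ⊗₁ Id D)
  | triangle A B : (Id A ⊗₁ LUnit B) ∘ Assoc A Unit B ≈ RUnit A ⊗₁ Id B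
  | hexagon A B C :
      Assoc B C A ∘ Braid A (B ⊗ C) ∘ Assoc A B C
      ≈ (Id B ⊗₁ Braid A C) ∘ Assoc B A C ∘ (Braid A B ⊗₁ Id C)
  | mu_assoc A : μ A ∘ T₁ (μ A) ≈ μ A ∘ μ (T A)
  | mu_etaT A : μ A ∘ η (T A) ≈ Id (T A)
  | mu_Teta A : μ A ∘ T₁ (η A) ≈ Id (T A)
  | psiL_assoc A B C :
      T₁ (Assoc A B C) ∘ ψL (A ⊗ B) C ∘ (ψL A B ⊗₁ Id C)
      ≈ ψL A (B ⊗ C) ∘ Assoc (T A) B C
  | psiL_unit A : T₁ (RUnit A) ∘ ψL A Unit ≈ RUnit (T A)
  | psiR_assoc A B C :
      T₁ (Assoc A B C) ∘ ψR (A ⊗ B) C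
      ≈ ψR A (B ⊗ C) ∘ (Id A ⊗₁ ψR B C) ∘ Assoc A B (T C)
  | psiR_unit A : T₁ (LUnit A) ∘ ψR Unit A ≈ LUnit (T A)
  | psiRL_assoc A B C :
      T₁ (Assoc A B C) ∘ ψL (A ⊗ B) C ∘ (ψR A B ⊗₁ Id C)
      ≈ ψR A (B ⊗ C) ∘ (Id A ⊗₁ ψL B C) ∘ Assoc A (T B) C
  | psiL_eta A B : ψL A B ∘ (η A ⊗₁ Id B) ≈ η (A ⊗ B)
  | psiR_eta A B : ψR A B ∘ (Id A ⊗₁ η B) ≈ η (A ⊗ B)
  | psiL_mu A B :
      ψL A B ∘ (μ A ⊗₁ Id B) ≈ μ (A ⊗ B) ∘ T₁ (ψL A B) ∘ ψL (T A) B
  | psiR_mu A B :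
      ψR A B ∘ (Id A ⊗₁ μ B) ≈ μ (A ⊗ B) ∘ T₁ (ψR A B) ∘ ψR A (T B)
  | psiLR_mu A B :
      μ (A ⊗ B) ∘ T₁ (ψL A B) ∘ ψR (T A) B
      ≈ μ (A ⊗ B) ∘ T₁ (ψR A B) ∘ ψL A (T B)
  | psi_braid A B : T₁ (Braid A B) ∘ ψL A B ≈ ψR B A ∘ Braid (T A) B
where "f ≈ g" := (eqarr f g) : lc_scope.

Definition LcS (P : Type) : category :=
  @Category (obj P) (@arr P) (@eqarr P) (@Id P) (@Comp P)
    (@eqarr_refl P) (@eqarr_sym P) (@eqarr_trans P) (@eqarr_comp P)
    (@cat_idl P) (@cat_idr P) (@cat_assoc P).

Definition Fun : category.
Proof.
refine (@Category nat (fun n m => 'I_n -> 'I_m) (fun n m f g => f =1 g)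
          (fun n => id) (fun n m p g f => g \o f) _ _ _ _ _ _ _) => //=.
- by move=> n m f g fg x; rewrite fg.
- by move=> n m f g h fg gh x; rewrite fg gh.
- by move=> n m p g g' f f' gg' ff' x /=; rewrite ff' gg'.
Defined.

(* Occurrences are counted from right to left: in [A ⊗ B] those in [B] come
   first, and are embedded by [lshift], those in [A] by [rshift]; in [T A] the
   outermost [T] is the greatest element [ord_max]. *)
Fixpoint G_ob (P : Type) (A : obj P) : nat :=
  match A with
  | Letter _ => 1
  | Unit => 0
  | A ⊗ B => G_ob B + G_ob A
  | T A => (G_ob A).+1
  end.

(* [f] acts on the left factor, i.e. on the larger elements. *)
Definition fun_tens n n' m m' (f : 'I_n -> 'I_n') (g : 'I_m -> 'I_m')
    (k : 'I_(m + n)) : 'I_(m' + n') :=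
  match split k with
  | inl j => lshift n' (g j)
  | inr i => rshift m' (f i)
  end.

Definition fun_T n m (f : 'I_n -> 'I_m) (k : 'I_n.+1) : 'I_m.+1 :=
  if unlift ord_max k is Some i then lift ord_max (f i) else ord_max.

(* [n = GA] and [m = GB] in the next two definitions. *)
Definition fun_braid n m (k : 'I_(m + n)) : 'I_(n + m) :=
  match split k with
  | inl j => rshift n j
  | inr i => lshift m i
  end.

Definition fun_psiR n m (k : 'I_(m.+1 + n)) : 'I_(m + n).+1 :=
  match split k with
  | inl j => if unlift ord_max j is Some j' then lift ord_max (lshift n j')
             else ord_max
  | inr i => lift ord_max (rshift m i)
  end.

Definition fun_eta n (k : 'I_n) : 'I_n.+1 := widen_ord (leqnSn n) k.

Definition fun_mu n (k : 'I_n.+2) : 'I_n.+1 :=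
  if unlift ord_max k is Some i then i else ord_max.

(* The identity functions between equal ordinals are [cast_ord]s. *)
Fixpoint G_arr (P : Type) (A B : obj P) (f : arr A B) :
    'I_(G_ob A) -> 'I_(G_ob B) :=
  match f in arr A B return 'I_(G_ob A) -> 'I_(G_ob B) with
  | Id A => id
  | Comp _ _ _ g f => G_arr g \o G_arr f
  | TensArr _ _ _ _ f g => fun_tens (G_arr f) (G_arr g)
  | T₁ _ _ f => fun_T (G_arr f)
  | Assoc A B C => cast_ord (addnA (G_ob C) (G_ob B) (G_ob A))
  | AssocInv A B C => cast_ord (esym (addnA (G_ob C) (G_ob B) (G_ob A)))
  | LUnit A => cast_ord (addn0 (G_ob A))
  | LUnitInv A => cast_ord (esym (addn0 (G_ob A)))
  | RUnit A => cast_ord (add0n (G_ob A))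
  | RUnitInv A => cast_ord (esym (add0n (G_ob A)))
  | Braid A B => @fun_braid (G_ob A) (G_ob B)
  | η A => @fun_eta (G_ob A)
  | μ A => @fun_mu (G_ob A)
  | ψL A B => cast_ord (addnS (G_ob B) (G_ob A))
  | ψR A B => @fun_psiR (G_ob A) (G_ob B)
  end.

(* [G_arr] on the underlying natural numbers; used only to show that [G_arr]
   is compatible with the equations. *)
Fixpoint G_nat (P : Type) (A B : obj P) (f : arr A B) : nat -> nat :=
  match f with
  | Comp _ _ _ g f => fun k => G_nat g (G_nat f k)
  | TensArr _ _ B B' f g => fun k =>
      if k < G_ob B then G_nat g k else G_ob B' + G_nat f (k - G_ob B)
  | T₁ A B f => fun k => if k < G_ob A then G_nat f k else G_ob B
  | Braid A B => fun k => if k < G_ob B then G_ob A + k else k - G_ob B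
  | μ A => fun k => if k < (G_ob A).+1 then k else G_ob A
  | ψR A B => fun k =>
      if k < G_ob B then k else
      if k == G_ob B then G_ob B + G_ob A else k.-1
  | _ => id
  end.

Ltac split_ifs :=
  repeat match goal with
  | |- context [if ?b then _ else _] =>
      lazymatch b with
      | context [if _ then _ else _] => fail
      | _ => destruct b eqn:?
      end
  end.

Local Lemma unlift_maxP n (k : 'I_n.+1) :
  match unlift ord_max k with
  | Some i => k < n /\ val i = k
  | None => val k = n
  end.
Proof.
case: unliftP => [j ->|-> //].
by rewrite lift_max.
Qed.

Lemma G_natE (P : Type) (A B : obj P) (f : arr A B) (k : 'I_(G_ob A)) :
  val (G_arr f k) = G_nat f (val k).
Proof.
elim: f k => //=.
- by move=> {}A {}B C g IHg f IHf k; rewrite IHg IHf.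
- move=> A1 A2 B1 B2 f IHf g IHg k; rewrite /fun_tens.
  case: splitP => j kE /=; first by rewrite IHg kE.
  by rewrite IHf kE addKn.
- move=> A1 A2 f IHf k; rewrite /fun_T.
  have := unlift_maxP k; case: unlift => [i [lt_k iE]|kE].
    by rewrite lift_max IHf lt_k iE.
  by rewrite kE ltnn.
- move=> A1 A2 k; rewrite /fun_braid.
  case: splitP => j kE /=; first by rewrite kE.
  by rewrite kE addKn.
- move=> A1 k; rewrite /fun_mu.
  have := unlift_maxP k; case: unlift => [i [lt_k iE]|kE].
    by rewrite lt_k.
  by rewrite kE ltnn.
- move=> A1 A2 k; rewrite /fun_psiR.
  case: splitP => j kE /=.
    have := unlift_maxP j; case: unlift => [i [lt_j iE]|jE].
      by rewrite lift_max /= kE lt_j.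
    by rewrite /= kE jE ltnn eqxx.
  by rewrite /bump kE; have := ltn_ord j; split_ifs; lia.
Qed.

Lemma G_nat_lt (P : Type) (A B : obj P) (f : arr A B) k :
  k < G_ob A -> G_nat f k < G_ob B.
Proof.
by move=> lt_k; have := ltn_ord (G_arr f (Ordinal lt_k)); rewrite G_natE.
Qed.

Lemma G_nat_eq (P : Type) (A B : obj P) (f g : arr A B) :
  eqarr f g -> forall k, k < G_ob A -> G_nat f k = G_nat g k.
Proof.
elim=> {A B f g} //=; try by intros; split_ifs; lia.
- by move=> A B f g _ IH k lt_k; rewrite IH.
- by move=> A B f g h _ IHf _ IHg k lt_k; rewrite IHf ?IHg.
- by move=> A B C g g' f f' _ IHg _ IHf k lt_k; rewrite IHg ?G_nat_lt ?IHf.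
- move=> A A' B B' f f' g g' _ IHf _ IHg k lt_k.
  by case: ltnP => le_k; rewrite ?IHg ?IHf //; lia.
- by move=> A B f f' _ IH k lt_k; case: ifP => // /IH.
- move=> A A' A'' B B' B'' f' f g' g k lt_k.
  case: ltnP => le_k; first by rewrite G_nat_lt.
  by rewrite ltnNge leq_addr addKn.
- by move=> A B C g f k lt_k; case: ifP => le_k; rewrite ?ltnn ?G_nat_lt.
- move=> A A' B B' C C' f g h k lt_k.
  by split_ifs; rewrite ?subnDA ?addnA //; lia.
- by move=> A A' f k lt_k; rewrite subn0.
- move=> A A' B B' f g k lt_k.
  case: (ltnP k (G_ob B)) => le_k; last first.
    by rewrite ltnNge leq_addr addKn ifT //; lia.
  by rewrite G_nat_lt // ifF ?addKn //; lia.
- move=> A A' f k lt_k; case: (ltnP k (G_ob A).+1) => le_k; last first.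
    by rewrite !ltnn.
  case: (ltnP k (G_ob A)) => [lt_kA|_]; last by rewrite ltnSn.
  by rewrite ltnS ltnW // G_nat_lt.
- move=> A A' B B' f g k lt_k.
  case: (ltngtP k (G_ob B)) => [lt_kB|gt_kB|->].
  + have lt_kS : k < (G_ob B).+1 by lia.
    by rewrite lt_kS (G_nat_lt g lt_kB) (ltn_addr _ lt_kB) lt_kB.
  + have -> : (k < (G_ob B).+1) = false by lia.
    have -> : k - (G_ob B).+1 = k.-1 - G_ob B by lia.
    by split_ifs; lia.
  + by split_ifs; lia.
Qed.

Lemma G_arr_eq (P : Type) (A B : obj P) (f g : arr A B) :
  eqarr f g -> G_arr f =1 G_arr g.
Proof.
move=> fg k; apply: val_inj; rewrite !G_natE.
exact: G_nat_eq fg _ (ltn_ord k).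
Qed.

Definition G (P : Type) : functor (LcS P) Fun :=
  @Functor (LcS P) Fun (@G_ob P) (@G_arr P) (@G_arr_eq P)
    (fun A k => erefl) (fun A B C g f k => erefl).

(* Main.v *)
Require Import Defs.
From mathcomp Require Import all_boot zify.
From Stdlib Require Import Setoid Morphisms Eqdep.

Set Implicit Arguments.
Unset Strict Implicit.
Unset Printing Implicit Defensive.

Local Open Scope lc_scope.

(** An object is a forest: the occurrences of T are inner nodes, the letters are
leaves, and an arrow acts on these nodes by its graph [G_nat].  Faithfulness
([graph_faithful]) is proved by induction on the target, each case of which
cancels the outermost connective of the target in a way that the graph alone
dictates.

If the target is [B ⊗ C], every tree of the source lands entirely in [B] or
entirely in [C]; the graph says which.  Sorting the trees of the source
accordingly is an invertible arrow [sift c], and the arrow is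
[(f1 ⊗₁ f2) ∘ sift c] ([tensor_decomposition]).

If the target is [T B], some occurrences of T in the source are sent to the
outermost T of the target, and the graph says which.  These are closed under
passing to an enclosing T, so that they can all be merged into a single
outermost T by an arrow [flatten m], built from [η], [μ] and the multiplication
[merge] of the commutative monad; and the arrow is [T₁ f' ∘ flatten m]
([T_decomposition]).

If the target is a letter or [Unit], or more generally contains no T, only
symmetric monoidal structure is involved, and coherence is proved by pulling out
the letters of the target one by one ([letters_tracked], [T_free_coherence]).

The three decompositions come from naturality statements of one shape: a piece
of combinatorial data on the target of an arrow (a letter, a colouring of the
trees by two colours, a set of occurrences of T to be merged) can be pulled back
along the graph of the arrow, and the canonical arrows attached to the data on
the two sides form a commuting square with the arrow.  Such a statement composes,
hence it only has to be checked on generators.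

The diagrams of symmetric monoidal structure met when [sift] is treated are
themselves instances of the coherence for targets without T, applied to letters
for which arbitrary objects are then substituted ([smc_coherence]). *)

(** * Rewriting with the equality of arrows *)

#[local] Instance eqarr_equivalence (P : Type) (A B : obj P) :
  Equivalence (@eqarr P A B).
Proof.
split=> [f|f g|f g h]; [exact: eqarr_refl|exact: eqarr_sym|exact: eqarr_trans].
Qed.

#[local] Instance Comp_proper (P : Type) (A B C : obj P) :
  Proper (@eqarr P B C ==> @eqarr P A B ==> @eqarr P A C) (@Comp P A B C).
Proof. by move=> g g' gg f f' ff; apply: eqarr_comp. Qed.

#[local] Instance TensArr_proper (P : Type) (A A' B B' : obj P) :
  Proper (@eqarr P A A' ==> @eqarr P B B' ==> @eqarr P (A ⊗ B) (A' ⊗ B'))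
    (@TensArr P A A' B B').
Proof. by move=> f f' ff g g' gg; apply: eqarr_tens. Qed.

#[local] Instance T₁_proper (P : Type) (A B : obj P) :
  Proper (@eqarr P A B ==> @eqarr P (T A) (T B)) (@T₁ P A B).
Proof. by move=> f f' ff; apply: eqarr_T. Qed.

#[local] Hint Resolve eqarr_refl : core.

(** * Symmetric monoidal identities *)

Section Monoidal.
Variable P : Type.
Implicit Types A B C D X Y : obj P.

(** [pull] and its mirror image [push] serve to rewrite [g ∘ f] inside a longer
composite, associated to the right and to the left respectively. *)
Lemma pull A B C D (g : arr B C) (f : arr A B) (h : arr A C) :
  g ∘ f ≈ h -> forall k : arr D A, g ∘ (f ∘ k) ≈ h ∘ k.
Proof. by move=> gf k; rewrite -cat_assoc gf. Qed.

Lemma push A B C D (g : arr B C) (f : arr A B) (h : arr A C) :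
  g ∘ f ≈ h -> forall k : arr C D, (k ∘ g) ∘ f ≈ k ∘ h.
Proof. by move=> gf k; rewrite cat_assoc gf. Qed.

Lemma tens_compl A A' A'' B (g : arr A' A'') (f : arr A A') :
  (g ∘ f) ⊗₁ Id B ≈ (g ⊗₁ Id B) ∘ (f ⊗₁ Id B).
Proof. by rewrite -tens_comp cat_idl. Qed.

Lemma tens_compr A A' A'' B (g : arr A' A'') (f : arr A A') :
  Id B ⊗₁ (g ∘ f) ≈ (Id B ⊗₁ g) ∘ (Id B ⊗₁ f).
Proof. by rewrite -tens_comp cat_idl. Qed.

Lemma tens_lr A A' B B' (f : arr A A') (g : arr B B') :
  (f ⊗₁ Id B') ∘ (Id A ⊗₁ g) ≈ f ⊗₁ g.
Proof. by rewrite -tens_comp cat_idl cat_idr. Qed.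

Lemma epi_cancel A B C (f g : arr B C) (s : arr A B) (t : arr B A) :
  s ∘ t ≈ Id B -> f ∘ s ≈ g ∘ s -> f ≈ g.
Proof.
by move=> st fg; rewrite -(cat_idr f) -(cat_idr g) -st -!cat_assoc fg.
Qed.

Lemma mono_cancel A B C (f g : arr A B) (s : arr B C) (t : arr C B) :
  t ∘ s ≈ Id B -> s ∘ f ≈ s ∘ g -> f ≈ g.
Proof.
by move=> ts fg; rewrite -(cat_idl f) -(cat_idl g) -ts !cat_assoc fg.
Qed.

Lemma lunit_faithful A B (f g : arr A B) :
  Id Unit ⊗₁ f ≈ Id Unit ⊗₁ g -> f ≈ g.
Proof.
move=> fg; apply: (epi_cancel (lunit_invr A)).
by rewrite -!lunit_nat fg.
Qed.

Lemma runit_faithful A B (f g : arr A B) :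
  f ⊗₁ Id Unit ≈ g ⊗₁ Id Unit -> f ≈ g.
Proof.
move=> fg; apply: (epi_cancel (runit_invr A)).
by rewrite -!runit_nat fg.
Qed.

Lemma assoc_inv_nat A A' B B' C C' (f : arr A A') (g : arr B B')
    (h : arr C C') :
  AssocInv A' B' C' ∘ (f ⊗₁ (g ⊗₁ h)) ≈ ((f ⊗₁ g) ⊗₁ h) ∘ AssocInv A B C.
Proof.
apply: (epi_cancel (assoc_invr A B C)).
rewrite !cat_assoc -assoc_nat assoc_invl cat_idr.
by rewrite -cat_assoc assoc_invl cat_idl.
Qed.

Lemma lunit_inv_nat A B (f : arr A B) :
  LUnitInv B ∘ f ≈ (Id Unit ⊗₁ f) ∘ LUnitInv A.
Proof.
apply: (mono_cancel (lunit_invl B)).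
rewrite -cat_assoc lunit_invr cat_idl -cat_assoc lunit_nat.
by rewrite (push (lunit_invr _)) cat_idr.
Qed.

Lemma runit_inv_nat A B (f : arr A B) :
  RUnitInv B ∘ f ≈ (f ⊗₁ Id Unit) ∘ RUnitInv A.
Proof.
apply: (mono_cancel (runit_invl B)).
rewrite -cat_assoc runit_invr cat_idl -cat_assoc runit_nat.
by rewrite (push (runit_invr _)) cat_idr.
Qed.

(** Kelly's argument: tensoring with the unit on the left is faithful, and after
it the equation becomes the pentagon for I, I, A, B, up to triangles. *)
Lemma lunit_assoc A B : LUnit (A ⊗ B) ∘ Assoc Unit A B ≈ LUnit A ⊗₁ Id B.
Proof.
apply: lunit_faithful.
have iso : (Assoc Unit (Unit ⊗ A) B ∘ (Assoc Unit Unit A ⊗₁ Id B)) ∘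
   ((AssocInv Unit Unit A ⊗₁ Id B) ∘ AssocInv Unit (Unit ⊗ A) B) ≈ Id _.
  rewrite cat_assoc (pull (h := Id _)) ?cat_idl ?assoc_invr //.
  by rewrite -tens_compl assoc_invr tens_id.
apply: (epi_cancel iso).
rewrite tens_compr cat_assoc -(cat_assoc (Id _ ⊗₁ Assoc _ _ _)) -pentagon.
rewrite (pull (triangle _ _)).
rewrite -tens_id -assoc_nat -triangle tens_compl -cat_assoc assoc_nat.
by rewrite cat_assoc.
Qed.

(** As for [lunit_assoc], with the unit tensored on the right and the pentagon
for A, B, I, I. *)
Lemma runit_assoc A B : (Id A ⊗₁ RUnit B) ∘ Assoc A B Unit ≈ RUnit (A ⊗ B).
Proof.
apply: runit_faithful.
apply: (mono_cancel (assoc_invl A B Unit)).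
rewrite -triangle -cat_assoc -tens_id assoc_nat.
rewrite (cat_assoc _ (Assoc _ _ _)) pentagon -!cat_assoc -tens_compr triangle.
rewrite -assoc_nat tens_compl -!cat_assoc; apply: eqarr_comp => //.
Qed.

Lemma lunit_unit : LUnit (@Unit P) ≈ RUnit Unit.
Proof.
apply: runit_faithful; rewrite -triangle -lunit_assoc.
apply: eqarr_comp => //.
apply: (mono_cancel (lunit_invl _)).
by rewrite lunit_nat.
Qed.

(** The hexagon whose second and third objects are the unit becomes this equation
tensored with the unit. *)
Lemma lunit_braid A : LUnit A ∘ Braid A Unit ≈ RUnit A.
Proof.
apply: runit_faithful.
apply: (mono_cancel (braid_inv A Unit)).
rewrite tens_compl -lunit_assoc.
rewrite -!cat_assoc -lunit_nat !cat_assoc -(cat_assoc (Id _ ⊗₁ _)).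
rewrite -hexagon -!cat_assoc lunit_assoc -braid_nat.
by rewrite (push (triangle _ _)).
Qed.

Lemma runit_braid A : RUnit A ∘ Braid Unit A ≈ LUnit A.
Proof.
by rewrite -lunit_braid cat_assoc braid_inv cat_idr.
Qed.

(** The exchange of two neighbours in a tensor product associated to the right.
It is locked so that rewriting with associativity does not look inside. *)
Definition swap A B X : arr (A ⊗ (B ⊗ X)) (B ⊗ (A ⊗ X)) :=
  locked (Assoc B A X ∘ (Braid A B ⊗₁ Id X) ∘ AssocInv A B X).

Lemma swapE A B X :
  swap A B X = Assoc B A X ∘ (Braid A B ⊗₁ Id X) ∘ AssocInv A B X.
Proof. by rewrite /swap -lock. Qed.

Lemma swap_nat A A' B B' X X' (f : arr A A') (g : arr B B') (h : arr X X') :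
  swap A' B' X' ∘ (f ⊗₁ (g ⊗₁ h)) ≈ (g ⊗₁ (f ⊗₁ h)) ∘ swap A B X.
Proof.
rewrite !swapE cat_assoc assoc_inv_nat -!cat_assoc; apply: eqarr_comp => //.
rewrite -assoc_nat !cat_assoc; apply: eqarr_comp => //.
by rewrite -!tens_comp braid_nat cat_idl cat_idr.
Qed.

Lemma swapK A B X : swap B A X ∘ swap A B X ≈ Id _.
Proof.
rewrite !swapE !cat_assoc (pull (assoc_invl _ _ _)) cat_idl.
rewrite (pull (h := Id _)) ?cat_idl ?assoc_invr //.
by rewrite -tens_compl braid_inv tens_id.
Qed.

Lemma swap_unit A B : (Id A ⊗₁ LUnit B) ∘ swap Unit A B ≈ LUnit (A ⊗ B).
Proof.
apply: (epi_cancel (assoc_invr _ _ _)).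
rewrite swapE !cat_assoc assoc_invl cat_idr -cat_assoc triangle.
by rewrite -tens_compl runit_braid lunit_assoc.
Qed.

Lemma assoc_braid A B C :
  Assoc B C A ∘ Braid A (B ⊗ C) ≈ (Id B ⊗₁ Braid A C) ∘ swap A B C.
Proof.
apply: (epi_cancel (assoc_invr _ _ _)).
by rewrite hexagon swapE !cat_assoc assoc_invl cat_idr.
Qed.

(** In strict notation both sides exchange A and B, leaving C and D in place:
only pentagons are involved. *)
Lemma swap_assocM A B C D :
  swap A B (C ⊗ D) ∘ (Id A ⊗₁ Assoc B C D) ∘ Assoc A (B ⊗ C) D
  ≈ (Id B ⊗₁ Assoc A C D) ∘ Assoc B (A ⊗ C) D ∘ (swap A B C ⊗₁ Id D).
Proof.
have iso : (Assoc A B C ⊗₁ Id D) ∘ (AssocInv A B C ⊗₁ Id D) ≈ Id _.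
  by rewrite -tens_compl assoc_invr tens_id.
apply: (epi_cancel iso).
rewrite !cat_assoc -(cat_assoc (Id A ⊗₁ _)) -pentagon.
rewrite -tens_compl !swapE (push (assoc_invl _ _ _)) cat_idr.
rewrite !cat_assoc (pull (assoc_invl _ _ _)) cat_idl.
rewrite tens_compl -!cat_assoc -pentagon.
by rewrite !cat_assoc; apply: eqarr_comp => //; rewrite -tens_id -assoc_nat.
Qed.

Lemma braid_swap A B C :
  Braid (A ⊗ B) C ≈ swap A C B ∘ (Id A ⊗₁ Braid B C) ∘ Assoc A B C.
Proof.
apply: (mono_cancel (braid_inv C (A ⊗ B))).
rewrite braid_inv.
apply: (mono_cancel (assoc_invl A B C)); rewrite cat_idr.
rewrite -(cat_assoc (Assoc A B C)) assoc_braid.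
rewrite !cat_assoc (pull (swapK _ _ _)) cat_idl -cat_assoc.
by rewrite -tens_compr braid_inv tens_id cat_idl.
Qed.

(** In strict notation, C moves across [A ⊗ B] at once or in two steps: this is
the hexagon, in the form [braid_swap]. *)
Lemma swap_assocR A B C D :
  swap A C (B ⊗ D) ∘ (Id A ⊗₁ swap B C D) ∘ Assoc A B (C ⊗ D)
  ≈ (Id C ⊗₁ Assoc A B D) ∘ swap (A ⊗ B) C D.
Proof.
apply: (epi_cancel (assoc_invr _ _ _)).
rewrite [swap (A ⊗ B) C D]swapE !cat_assoc assoc_invl cat_idr braid_swap.
rewrite !tens_compl !cat_assoc.
rewrite -(cat_assoc (Id C ⊗₁ _)) -(cat_assoc (_ ∘ Assoc _ _ _)).
rewrite -swap_assocM !cat_assoc.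
apply: eqarr_comp => //.
rewrite -(cat_assoc (Assoc A (C ⊗ B) D)) assoc_nat cat_assoc pentagon.
rewrite -!cat_assoc; apply: eqarr_comp => //; apply: eqarr_comp => //.
by rewrite -!tens_compr swapE (push (assoc_invl _ _ _)) cat_idr.
Qed.

End Monoidal.

(** * Letters have a unique preimage *)

Section Letters.
Variable P : Type.
Implicit Types A B C D X Y : obj P.

(** The occurrences of letters that lie inside no T. *)
Fixpoint pos A : Type :=
  match A with
  | Letter _ => unit
  | A ⊗ B => pos A + pos B
  | _ => Empty_set
  end.

Fixpoint lett A : pos A -> P :=
  match A with
  | Letter p => fun=> p
  | Unit => fun q => match q with end
  | A ⊗ B => fun q => match q with inl q => lett q | inr q => lett q end
  | T _ => fun q => match q with end
  end.

(** The object in which the given occurrence is replaced by the unit; the unit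
left behind by the recursion is not removed. *)
Fixpoint rest A : pos A -> obj P :=
  match A with
  | Letter p => fun=> Unit
  | Unit => fun q => match q with end
  | A ⊗ B => fun q =>
      match q with inl q => rest q ⊗ B | inr q => A ⊗ rest q end
  | T _ => fun q => match q with end
  end.

(** The element of [G_ob A] that corresponds to the occurrence. *)
Fixpoint position A : pos A -> nat :=
  match A with
  | Letter p => fun=> 0
  | Unit => fun q => match q with end
  | A ⊗ B => fun q =>
      match q with inl q => G_ob B + position q | inr q => position q end
  | T _ => fun q => match q with end
  end.

Fixpoint extract A : forall q : pos A, arr A (Letter (lett q) ⊗ rest q) :=
  match A with
  | Letter p => fun=> RUnitInv _
  | Unit => fun q => match q with end
  | A ⊗ B => fun q =>
      match q with
      | inl q => Assoc _ _ _ ∘ (extract q ⊗₁ Id B)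
      | inr q => swap _ _ _ ∘ (Id A ⊗₁ extract q)
      end
  | T _ => fun q => match q with end
  end.

Fixpoint restore A : forall q : pos A, arr (Letter (lett q) ⊗ rest q) A :=
  match A with
  | Letter p => fun=> RUnit _
  | Unit => fun q => match q with end
  | A ⊗ B => fun q =>
      match q with
      | inl q => (restore q ⊗₁ Id B) ∘ AssocInv _ _ _
      | inr q => (Id A ⊗₁ restore q) ∘ swap _ _ _
      end
  | T _ => fun q => match q with end
  end.

Lemma extractK A (q : pos A) : restore q ∘ extract q ≈ Id A.
Proof.
elim: A q => [p _|[]|A IHA B IHB [q|q]|? _ []] /=; first exact: runit_invr.
  rewrite cat_assoc (pull (assoc_invl _ _ _)) cat_idl -tens_compl IHA.
  by rewrite tens_id.
rewrite cat_assoc (pull (swapK _ _ _)) cat_idl -tens_compr IHB.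
by rewrite tens_id.
Qed.

Lemma restoreK A (q : pos A) : extract q ∘ restore q ≈ Id _.
Proof.
elim: A q => [p _|[]|A IHA B IHB [q|q]|? _ []] /=; first exact: runit_invl.
  rewrite cat_assoc (pull (f := restore q ⊗₁ _) (h := Id _)) ?cat_idl ?assoc_invr //.
  by rewrite -tens_compl IHA tens_id.
rewrite cat_assoc (pull (f := _ ⊗₁ restore q) (h := Id _)) ?cat_idl ?swapK //.
by rewrite -tens_compr IHB tens_id.
Qed.

Lemma position_lt A (q : pos A) : position q < G_ob A.
Proof.
elim: A q => [p|[]|A IHA B IHB [q|q]|? _ []] //=; first by rewrite ltn_add2l IHA.
by rewrite (leq_trans (IHB q)) // leq_addr.
Qed.

Lemma position_inj A : injective (@position A).
Proof.
elim: A => [p|[]|A IHA B IHB|? _ []] /=; first by case; case.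
move=> [q|q] [q'|q'] /= E; have := position_lt q; have := position_lt q'.
- by move=> _ _; congr inl; apply: IHA; lia.
- by lia.
- by lia.
- by move=> _ _; congr inr; apply: IHB.
Qed.

(** Letters of source and target agree only up to a proof of equality, which may
not be trivial: this is the arrow that it induces. *)
Definition letter_cast (p p' : P) (E : p = p') : arr (Letter p) (Letter p') :=
  match E with erefl => Id _ end.

(** The first clause says that [q'] is the only preimage of [q], so that it depends
on the graph of [h] only. *)
Definition tracks_letters A C (h : arr A C) : Prop :=
  forall q : pos C, exists (q' : pos A) (E : lett q' = lett q)
    (h' : arr (rest q') (rest q)),
    (forall k, k < G_ob A -> (G_nat h k == position q) = (k == position q')) /\
    extract q ∘ h ≈ (letter_cast E ⊗₁ h') ∘ extract q'.

Lemma letter_cast_trans (p1 p2 p3 : P) (E : p1 = p2) (E' : p2 = p3) :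
  letter_cast E' ∘ letter_cast E ≈ letter_cast (etrans E E').
Proof. by case: p3 / E'; rewrite /= cat_idl. Qed.

Lemma tracks_comp A B C (g : arr B C) (f : arr A B) :
  tracks_letters g -> tracks_letters f -> tracks_letters (g ∘ f).
Proof.
move=> tg tf q; have [q1 [E1 [g' [ixg eg]]]] := tg q.
have [q2 [E2 [f' [ixf ef]]]] := tf q1.
exists q2, (etrans E2 E1), (g' ∘ f'); split => [k lt_k|].
  by rewrite /= ixg ?ixf ?G_nat_lt.
by rewrite -cat_assoc eg cat_assoc ef -letter_cast_trans tens_comp cat_assoc.
Qed.

Lemma tracks_tens A A' B B' (f : arr A A') (g : arr B B') :
  tracks_letters f -> tracks_letters g -> tracks_letters (f ⊗₁ g).
Proof.
move=> tf tg [q|q].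
  have [q1 [E1 [f' [ixf ef]]]] := tf q.
  exists (inl q1), E1, (f' ⊗₁ g); split.
    move=> k lt_k /=; rewrite /= in lt_k.
    case: ltnP => lt_kB; last by rewrite eqn_add2l ixf; lia.
    by have := G_nat_lt g lt_kB; lia.
  rewrite /= cat_assoc -tens_comp cat_idl ef -{1}(cat_idr g) tens_comp.
  by rewrite -cat_assoc assoc_nat cat_assoc.
have [q1 [E1 [g' [ixg eg]]]] := tg q.
exists (inr q1), E1, (f ⊗₁ g'); split.
  move=> k lt_k /=; rewrite /= in lt_k.
  case: ltnP => lt_kB; first by rewrite ixg.
  by have := position_lt q; have := position_lt q1; lia.
rewrite /= cat_assoc -tens_comp cat_idl eg -{1}(cat_idr f) tens_comp.
by rewrite -cat_assoc swap_nat cat_assoc.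
Qed.

Lemma flip_square A C X Y Y' (h : arr A C) (hi : arr C A) (h' : arr Y' Y)
    (hi' : arr Y Y') (e' : arr A (X ⊗ Y')) (e : arr C (X ⊗ Y)) :
  h ∘ hi ≈ Id C -> hi' ∘ h' ≈ Id Y' ->
  e ∘ h ≈ (Id X ⊗₁ h') ∘ e' -> e' ∘ hi ≈ (Id X ⊗₁ hi') ∘ e.
Proof.
move=> hhi hih eh.
rewrite -(cat_idr e) -hhi -(cat_assoc e) eh -!cat_assoc.
by rewrite -tens_compr hih tens_id cat_idl.
Qed.

Lemma tracks_assoc A B C : tracks_letters (Assoc A B C).
Proof.
move=> [q|[q|q]].
- exists (inl (inl q)), erefl, (Assoc _ _ _).
  split => [k _ /=|]; first by rewrite -addnA.
  rewrite /= cat_assoc -tens_id -assoc_nat -cat_assoc pentagon.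
  by rewrite tens_compl !cat_assoc.
- exists (inl (inr q)), erefl, (Assoc _ _ _); split => [k _ //=|].
  rewrite /= tens_compr tens_compl !cat_assoc -assoc_nat.
  by rewrite -!cat_assoc swap_assocM.
- exists (inr q), erefl, (Assoc _ _ _); split => [k _ //=|].
  rewrite /= tens_compr !cat_assoc -assoc_nat tens_id.
  by rewrite -!cat_assoc swap_assocR.
Qed.

Lemma tracks_assoc_inv A B C : tracks_letters (AssocInv A B C).
Proof.
move=> [[q|q]|q].
- exists (inl q), erefl, (AssocInv _ _ _).
  split => [k _ /=|]; first by rewrite -addnA.
  apply: (flip_square (h := Assoc A B C) (h' := Assoc _ _ _));
    rewrite ?assoc_invl ?assoc_invr //.
  rewrite /= cat_assoc -tens_id -assoc_nat -cat_assoc pentagon.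
  by rewrite tens_compl !cat_assoc.
- exists (inr (inl q)), erefl, (AssocInv _ _ _); split => [k _ //=|].
  apply: (flip_square (h := Assoc A B C) (h' := Assoc _ _ _));
    rewrite ?assoc_invl ?assoc_invr //.
  rewrite /= tens_compr tens_compl !cat_assoc -assoc_nat.
  by rewrite -!cat_assoc swap_assocM.
- exists (inr (inr q)), erefl, (AssocInv _ _ _); split => [k _ //=|].
  apply: (flip_square (h := Assoc A B C) (h' := Assoc _ _ _));
    rewrite ?assoc_invl ?assoc_invr //.
  rewrite /= tens_compr !cat_assoc -assoc_nat tens_id.
  by rewrite -!cat_assoc swap_assocR.
Qed.

Lemma extract_lunit A (q : pos A) :
  extract q ∘ LUnit A ≈ (Id _ ⊗₁ LUnit _) ∘ extract (inr q : pos (Unit ⊗ A)).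
Proof. by rewrite /= -lunit_nat -cat_assoc swap_unit. Qed.

Lemma extract_runit A (q : pos A) :
  extract q ∘ RUnit A ≈ (Id _ ⊗₁ RUnit _) ∘ extract (inl q : pos (A ⊗ Unit)).
Proof. by rewrite /= -runit_nat -cat_assoc runit_assoc. Qed.

Lemma extract_braid A B (q : pos B) :
  extract (inl q : pos (B ⊗ A)) ∘ Braid A B
  ≈ (Id _ ⊗₁ Braid _ _) ∘ extract (inr q : pos (A ⊗ B)).
Proof. by rewrite /= cat_assoc -braid_nat -!cat_assoc assoc_braid. Qed.

Lemma tracks_lunit A : tracks_letters (LUnit A).
Proof.
move=> q; exists (inr q), erefl, (LUnit _); split=> //; exact: extract_lunit.
Qed.

Lemma tracks_lunit_inv A : tracks_letters (LUnitInv A).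
Proof.
move=> [[]|q]; exists q, erefl, (LUnitInv _); split => //.
by apply: flip_square (extract_lunit q); rewrite ?lunit_invl ?lunit_invr.
Qed.

Lemma tracks_runit A : tracks_letters (RUnit A).
Proof.
move=> q; exists (inl q), erefl, (RUnit _); split=> //; exact: extract_runit.
Qed.

Lemma tracks_runit_inv A : tracks_letters (RUnitInv A).
Proof.
move=> [q|[]]; exists q, erefl, (RUnitInv _); split => //.
by apply: flip_square (extract_runit q); rewrite ?runit_invl ?runit_invr.
Qed.

Lemma tracks_braid A B : tracks_letters (Braid A B).
Proof.
move=> [q|q].
  exists (inr q), erefl, (Braid _ _); split; last exact: extract_braid.
  by move=> k /= lt_k; have ? := position_lt q; case: (ltnP k); lia.
exists (inl q), erefl, (Braid _ _); split.
  by move=> k /= lt_k; have ? := position_lt q; case: (ltnP k); lia.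
exact: (flip_square (braid_inv _ _) (braid_inv _ _) (extract_braid B q)).
Qed.

Theorem letters_tracked A C (h : arr A C) : tracks_letters h.
Proof.
elim: h => {A C}; try by move=> * [].
- move=> A q; exists q, erefl, (Id _); split => //.
  by rewrite tens_id cat_idl cat_idr.
- by move=> A B C g tg f tf; apply: tracks_comp.
- by move=> A A' B B' f tf g tg; apply: tracks_tens.
- exact: tracks_assoc.
- exact: tracks_assoc_inv.
- exact: tracks_lunit.
- exact: tracks_lunit_inv.
- exact: tracks_runit.
- exact: tracks_runit_inv.
- exact: tracks_braid.
Qed.

End Letters.

(** * Coherence for targets without T *)

Definition same_graph (P : Type) (A B : obj P) (f g : arr A B) : Prop :=
  forall k, k < G_ob A -> G_nat f k = G_nat g k.

Section Coherence.
Variable P : Type.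
Implicit Types A B C D X Y : obj P.

(** Since [t] is a right inverse of [s], the graphs of [g] and [g'] are those of
[f] and [f'] precomposed with the graph of [t]. *)
Lemma same_graph_cancel A B C (f f' : arr A C) (g g' : arr B C) (s : arr A B)
    (t : arr B A) :
  s ∘ t ≈ Id B -> f ≈ g ∘ s -> f' ≈ g' ∘ s -> same_graph f f' ->
  same_graph g g'.
Proof.
move=> st fg fg' ff' k lt_k.
have tP (h : arr B C) (e : arr A C) :
    e ≈ h ∘ s -> G_nat h k = G_nat e (G_nat t k).
  move=> eh; rewrite (G_nat_eq eh) ?G_nat_lt //=.
  rewrite -[in LHS](G_nat_eq (cat_idr h)) //.
  by rewrite -(G_nat_eq (eqarr_comp (eqarr_refl h) st)).
by rewrite (tP _ _ fg) (tP _ _ fg') ff' ?G_nat_lt.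
Qed.

Lemma same_graph_tens A A' B B' (f f' : arr A A') (g g' : arr B B') :
  same_graph (f ⊗₁ g) (f' ⊗₁ g') -> same_graph f f' /\ same_graph g g'.
Proof.
move=> E; split=> k lt_k.
  have := E (G_ob B + k); rewrite /= ltn_add2l lt_k => /(_ isT).
  by rewrite ltnNge leq_addr /= addKn => /addnI.
by have := E k; rewrite /= lt_k ltn_addr // => /(_ isT).
Qed.

(** The canonical arrow to the unit, for objects without letters and T. *)
Fixpoint collapse A : option (arr A Unit) :=
  match A with
  | Unit => Some (Id Unit)
  | A ⊗ B =>
      if collapse A is Some u then
        if collapse B is Some v then Some (LUnit Unit ∘ (u ⊗₁ v)) else None
      else None
  | _ => None
  end.

Lemma collapse_assoc A B C (u : arr A Unit) (v : arr B Unit) (w : arr C Unit) :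
  (LUnit Unit ∘ (u ⊗₁ (LUnit Unit ∘ (v ⊗₁ w)))) ∘ Assoc A B C
  ≈ LUnit Unit ∘ ((LUnit Unit ∘ (u ⊗₁ v)) ⊗₁ w).
Proof.
rewrite -{1}(cat_idl u) -{2}(cat_idl w) !tens_comp !cat_assoc -assoc_nat.
rewrite -!(cat_assoc (LUnit Unit)) -(cat_assoc _ (Assoc _ _ _)).
by rewrite (push (triangle _ _)) lunit_unit.
Qed.

(** Hence any two arrows into an object without letters and T are equal
([collapse_eq]). *)
Lemma collapse_nat A C (h : arr A C) u :
  collapse C = Some u -> exists2 v, collapse A = Some v & u ∘ h ≈ v.
Proof.
elim: h u => {A C} //=.
- by move=> A u Au; exists u => //; rewrite cat_idr.
- move=> A B C g IHg f IHf u /IHg[v /IHf[w Aw vw] uv].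
  by exists w => //; rewrite -cat_assoc uv vw.
- move=> A A' B B' f IHf g IHg u.
  case: (collapse A') IHf => // u1 /(_ _ erefl)[v1 -> e1].
  case: (collapse B') IHg => // u2 /(_ _ erefl)[v2 -> e2] [<-].
  by eexists; first by []; rewrite cat_assoc -tens_comp e1 e2.
- move=> A B C u.
  case: (collapse A) => // a; case: (collapse B) => // b.
  case: (collapse C) => // c [<-]; eexists; first by [].
  exact: collapse_assoc.
- move=> A B C u.
  case: (collapse A) => // a; case: (collapse B) => // b.
  case: (collapse C) => // c [<-]; eexists; first by [].
  by rewrite -collapse_assoc cat_assoc assoc_invr cat_idr.
- by move=> A u ->; eexists; first by []; rewrite lunit_nat.
- move=> A u; case: (collapse A) => // a [<-]; exists a => //.
  by rewrite lunit_nat cat_assoc lunit_invr cat_idr.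
- by move=> A u ->; eexists; first by []; rewrite lunit_unit runit_nat.
- move=> A u; case: (collapse A) => // a [<-]; exists a => //.
  by rewrite lunit_unit runit_nat cat_assoc runit_invr cat_idr.
- move=> A B u; case: (collapse B) => // b; case: (collapse A) => // a [<-].
  eexists; first by [].
  by rewrite cat_assoc -braid_nat -cat_assoc lunit_braid lunit_unit.
Qed.

Lemma collapse_mono A (u : arr A Unit) :
  collapse A = Some u -> exists u', u' ∘ u ≈ Id A.
Proof.
elim: A u => //= [u [<-]|A IHA B IHB u]; first by exists (Id _); rewrite cat_idl.
case: (collapse A) IHA => // a /(_ _ erefl)[a' aK].
case: (collapse B) IHB => // b /(_ _ erefl)[b' bK] [<-].
exists ((a' ⊗₁ b') ∘ LUnitInv Unit); rewrite cat_assoc (pull (lunit_invl _)).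
by rewrite cat_idl -tens_comp aK bK tens_id.
Qed.

Lemma collapse_eq A C (f g : arr A C) u : collapse C = Some u -> f ≈ g.
Proof.
move=> Cu; have [u' uK] := collapse_mono Cu; apply: (mono_cancel uK).
have [v Av fv] := collapse_nat f Cu.
have [v' Av' gv'] := collapse_nat g Cu; rewrite fv gv'.
by move: Av'; rewrite Av => -[->].
Qed.

Fixpoint T_free A : bool :=
  match A with
  | A ⊗ B => T_free A && T_free B
  | T _ => false
  | _ => true
  end.

Lemma T_freeP A :
  T_free A -> (exists u, collapse A = Some u) \/ (exists q : pos A, True).
Proof.
elim: A => //= [p _|_|A IHA B IHB]; first by right; exists tt.
  by left; exists (Id _).
case/andP=> /IHA[[u ->]|[q _]]; last by right; exists (inl q).
move/IHB=> [[v ->]|[q _]]; last by right; exists (inr q).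
by left; eexists.
Qed.

Lemma T_free_rest A (q : pos A) : T_free A -> T_free (rest q).
Proof.
elim: A q => [p|[]|A IHA B IHB [q|q]|? _ []] //= /andP[Af Bf]; apply/andP; split;
  by auto.
Qed.

Lemma G_ob_rest A (q : pos A) : G_ob A = (G_ob (rest q)).+1.
Proof.
elim: A q => [p|[]|A IHA B IHB [q|q]|? _ []] //=; first by rewrite (IHA q) addnS.
by rewrite (IHB q).
Qed.

(** While the target contains a letter, that letter can be pulled out of both
arrows, at the same place of the source because the graphs agree; the remaining
arrows are equal by induction.  A target without letters is isomorphic to the
unit.  Two proofs that a letter of the source equals a letter of the target must
be identified here, which is uniqueness of identity proofs for P. *)
Lemma T_free_coherence A C (f g : arr A C) :
  T_free C -> same_graph f g -> f ≈ g.
Proof.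
have [n] := ubnP (G_ob C); elim: n => // n IHn in A C f g * => lt_n Cf fg.
case: (T_freeP Cf) => [[u Cu]|[q _]]; first exact: collapse_eq Cu.
have [q1 [E1 [f' [ixf ef]]]] := letters_tracked f q.
have [q2 [E2 [g' [ixg eg]]]] := letters_tracked g q.
have q12 : q1 = q2.
  apply: position_inj; apply/eqP; rewrite -ixg ?position_lt //.
  by rewrite -fg ?position_lt // ixf ?position_lt.
rewrite -{}q12 in E2 g' eg ixg.
rewrite (UIP _ _ _ E2 E1) in eg.
apply: (mono_cancel (extractK q)); rewrite ef eg.
apply: eqarr_comp => //; apply: eqarr_tens => //; apply: IHn.
- by rewrite -ltnS -G_ob_rest.
- exact: T_free_rest.
apply: (proj2 (same_graph_tens (f := letter_cast E1) (f' := letter_cast E1) _)).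
apply: (same_graph_cancel (restoreK q1) ef eg) => k lt_k /=.
by rewrite fg.
Qed.

End Coherence.

(** * Deciding symmetric monoidal diagrams *)

Section Substitution.
Variables (L P : Type) (v : L -> obj P).

Fixpoint subst_ob (A : obj L) : obj P :=
  match A with
  | Letter x => v x
  | Unit => Unit
  | A ⊗ B => subst_ob A ⊗ subst_ob B
  | T A => T (subst_ob A)
  end.

Fixpoint subst_arr (A B : obj L) (f : arr A B) :
    arr (subst_ob A) (subst_ob B) :=
  match f in arr A B return arr (subst_ob A) (subst_ob B) with
  | Id A => Id _
  | Comp _ _ _ g f => subst_arr g ∘ subst_arr f
  | TensArr _ _ _ _ f g => subst_arr f ⊗₁ subst_arr g
  | T₁ _ _ f => T₁ (subst_arr f)
  | Assoc A B C => Assoc _ _ _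
  | AssocInv A B C => AssocInv _ _ _
  | LUnit A => LUnit _
  | LUnitInv A => LUnitInv _
  | RUnit A => RUnit _
  | RUnitInv A => RUnitInv _
  | Braid A B => Braid _ _
  | η A => η _
  | μ A => μ _
  | ψL A B => ψL _ _
  | ψR A B => ψR _ _
  end.

Lemma subst_eq (A B : obj L) (f g : arr A B) :
  f ≈ g -> subst_arr f ≈ subst_arr g.
Proof.
elim=> {A B f g} /=; try by constructor.
by move=> A B f g h _ fg _ gh; apply: eqarr_trans fg gh.
Qed.

End Substitution.

(** Equality of the graphs is tested on letters, by computation, and then holds for
all objects [s] substituted for the letters. *)
Lemma smc_coherence (P : Type) (s : seq (obj P)) (A B : obj nat)
    (f g : arr A B) :
  T_free B -> all (fun k => G_nat f k == G_nat g k) (iota 0 (G_ob A)) ->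
  subst_arr (nth Unit s) f ≈ subst_arr (nth Unit s) g.
Proof.
move=> Bf /allP fg; apply/subst_eq/T_free_coherence => // k lt_k.
by apply/eqP/fg; rewrite mem_iota.
Qed.

Ltac reify_atom s A :=
  lazymatch s with
  | A :: _ => constr:(0)
  | _ :: ?s' => let n := reify_atom s' A in constr:(S n)
  end.

Ltac reify_ob s A :=
  lazymatch A with
  | Unit => constr:(@Unit nat)
  | ?B ⊗ ?C =>
      let B' := reify_ob s B in let C' := reify_ob s C in constr:(B' ⊗ C')
  | _ => let n := reify_atom s A in constr:(@Letter nat n)
  end.

Ltac reify_arr s f :=
  lazymatch f with
  | Id ?A => let A' := reify_ob s A in constr:(Id A')
  | ?g ∘ ?f =>
      let g' := reify_arr s g in let f' := reify_arr s f in constr:(g' ∘ f')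
  | ?f ⊗₁ ?g =>
      let f' := reify_arr s f in let g' := reify_arr s g in constr:(f' ⊗₁ g')
  | Assoc ?A ?B ?C =>
      let A' := reify_ob s A in let B' := reify_ob s B in
      let C' := reify_ob s C in constr:(Assoc A' B' C')
  | AssocInv ?A ?B ?C =>
      let A' := reify_ob s A in let B' := reify_ob s B in
      let C' := reify_ob s C in constr:(AssocInv A' B' C')
  | LUnit ?A => let A' := reify_ob s A in constr:(LUnit A')
  | LUnitInv ?A => let A' := reify_ob s A in constr:(LUnitInv A')
  | RUnit ?A => let A' := reify_ob s A in constr:(RUnit A')
  | RUnitInv ?A => let A' := reify_ob s A in constr:(RUnitInv A')
  | Braid ?A ?B =>
      let A' := reify_ob s A in let B' := reify_ob s B in constr:(Braid A' B')
  end.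

(** [smc s] proves an equation of symmetric monoidal arrows by replacing the
objects of the list [s], regarded as atoms, by distinct letters. *)
Ltac smc s :=
  lazymatch goal with
  | |- ?f ≈ ?g =>
      let f' := reify_arr s f in let g' := reify_arr s g in
      exact (@smc_coherence _ s _ _ f' g' isT isT)
  end.

(** * A smaller set of generators *)

Section Generators.
Variable P : Type.
Implicit Types A B C D X Y : obj P.

Lemma assoc_inv_braid A B C :
  AssocInv A B C ≈
  Braid C (A ⊗ B) ∘ (Id C ⊗₁ Braid B A) ∘ Assoc C B A ∘ (Braid B C ⊗₁ Id A)
    ∘ Braid A (B ⊗ C).
Proof. smc [:: A; B; C]. Qed.

Lemma runit_inv_braid A : RUnitInv A ≈ Braid Unit A ∘ LUnitInv A.
Proof. smc [:: A]. Qed.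

Lemma psiR_braid A B :
  ψR A B ≈ T₁ (Braid B A) ∘ ψL B A ∘ Braid A (T B).
Proof. by rewrite psi_braid cat_assoc braid_inv cat_idr. Qed.

(** The remaining generators are composites of these, using the symmetry. *)
Theorem arr_ind_generators (Q : forall A B, arr A B -> Prop) :
  (forall A B (f g : arr A B), f ≈ g -> Q A B f -> Q A B g) ->
  (forall A, Q A A (Id A)) ->
  (forall A B C (g : arr B C) (f : arr A B),
     Q B C g -> Q A B f -> Q A C (g ∘ f)) ->
  (forall A A' B B' (f : arr A A') (g : arr B B'),
     Q A A' f -> Q B B' g -> Q (A ⊗ B) (A' ⊗ B') (f ⊗₁ g)) ->
  (forall A B (f : arr A B), Q A B f -> Q (T A) (T B) (T₁ f)) ->
  (forall A B C, Q _ _ (Assoc A B C)) ->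
  (forall A, Q _ _ (LUnit A)) ->
  (forall A, Q _ _ (LUnitInv A)) ->
  (forall A B, Q _ _ (Braid A B)) ->
  (forall A, Q _ _ (η A)) ->
  (forall A, Q _ _ (μ A)) ->
  (forall A B, Q _ _ (ψL A B)) ->
  forall A B (f : arr A B), Q A B f.
Proof.
move=> Qeq QId QComp QTens QT QAssoc QLUnit QLUnitInv QBraid Qeta Qmu QpsiL.
move=> A B f; elim: f => {A B}; do ?[by auto].
- move=> A B C; apply: Qeq (eqarr_sym (assoc_inv_braid A B C)) _.
  by auto 8.
- by move=> A; apply: Qeq (lunit_braid A) _; apply: QComp.
- by move=> A; apply: Qeq (eqarr_sym (runit_inv_braid A)) _; apply: QComp.
- move=> A B; apply: Qeq (eqarr_sym (psiR_braid A B)) _.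
  by auto.
Qed.

End Generators.

(** * Arrows into a tensor product *)

Section Splitting.
Variable P : Type.
Implicit Types A B C D X Y : obj P.

(** Locked for the same reason as [swap]. *)
Definition interchange A B C D : arr ((A ⊗ B) ⊗ (C ⊗ D)) ((A ⊗ C) ⊗ (B ⊗ D)) :=
  locked (AssocInv A C (B ⊗ D) ∘ (Id A ⊗₁ swap B C D) ∘ Assoc A B (C ⊗ D)).

Lemma interchangeE A B C D :
  interchange A B C D =
  AssocInv A C (B ⊗ D) ∘ (Id A ⊗₁ swap B C D) ∘ Assoc A B (C ⊗ D).
Proof. by rewrite /interchange -lock. Qed.

Lemma interchange_nat A A' B B' C C' D D' (f : arr A A') (g : arr B B')
    (h : arr C C') (i : arr D D') :
  interchange A' B' C' D' ∘ ((f ⊗₁ g) ⊗₁ (h ⊗₁ i))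
  ≈ ((f ⊗₁ h) ⊗₁ (g ⊗₁ i)) ∘ interchange A B C D.
Proof.
rewrite !interchangeE !cat_assoc assoc_nat.
rewrite -(cat_assoc (Id A' ⊗₁ _)) -tens_comp swap_nat cat_idl.
rewrite -{1}(cat_idr f) tens_comp cat_assoc -(cat_assoc (AssocInv _ _ _)).
by rewrite assoc_inv_nat !cat_assoc.
Qed.

Lemma interchangeK A B C D :
  interchange A C B D ∘ interchange A B C D ≈ Id _.
Proof. rewrite !interchangeE !swapE; smc [:: A; B; C; D]. Qed.

Lemma interchange_assoc A A' B B' C C' :
  interchange A A' (B ⊗ C) (B' ⊗ C') ∘ (Id _ ⊗₁ interchange B B' C C')
    ∘ Assoc (A ⊗ A') (B ⊗ B') (C ⊗ C')
  ≈ (Assoc A B C ⊗₁ Assoc A' B' C') ∘ interchange (A ⊗ B) (A' ⊗ B') C C'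
    ∘ (interchange A A' B B' ⊗₁ Id _).
Proof. rewrite !interchangeE !swapE; smc [:: A; A'; B; B'; C; C']. Qed.

Lemma interchange_braid A A' B B' :
  interchange B B' A A' ∘ Braid (A ⊗ A') (B ⊗ B')
  ≈ (Braid A B ⊗₁ Braid A' B') ∘ interchange A A' B B'.
Proof. rewrite !interchangeE !swapE; smc [:: A; A'; B; B']. Qed.

Lemma interchange_lunit A A' :
  (LUnit A ⊗₁ LUnit A') ∘ interchange Unit Unit A A'
    ∘ (LUnitInv Unit ⊗₁ Id (A ⊗ A')) ≈ LUnit (A ⊗ A').
Proof. rewrite !interchangeE !swapE; smc [:: A; A']. Qed.

(** A choice of one of two sides for each tree of the forest A; all the nodes of a
tree go to the same side, so a tree with root T carries a single boolean. *)
Fixpoint coloring A : Type :=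
  match A with
  | Letter _ | T _ => bool
  | Unit => unit
  | A ⊗ B => coloring A * coloring B
  end.

Fixpoint color A : coloring A -> nat -> bool :=
  match A with
  | Letter _ | T _ => fun b _ => b
  | Unit => fun _ _ => false
  | A ⊗ B => fun c k =>
      if k < G_ob B then color c.2 k else color c.1 (k - G_ob B)
  end.

(** The colours of a pulled back colouring are given by the graph of the arrow; thus
two arrows with the same graph pull back a colouring to the same colouring. *)
Lemma color_inj A (c c' : coloring A) :
  (forall k, k < G_ob A -> color c k = color c' k) -> c = c'.
Proof.
elim: A c c' => [p|[] []|A IHA B IHB [a b] [a' b']|A _] //=.
- by move=> c c' /(_ 0 isT).
- move=> cc'; congr pair.
    apply: IHA => k lt_k; have := cc' (G_ob B + k); rewrite ltn_add2l lt_k.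
    by rewrite ltnNge leq_addr addKn; apply.
  by apply: IHB => k lt_k; have := cc' k; rewrite lt_k ltn_addr //; apply.
- by move=> c c' /(_ 0 isT).
Qed.

Fixpoint monochrome (b : bool) A : coloring A :=
  match A with
  | Letter _ | T _ => b
  | Unit => tt
  | A ⊗ B => (monochrome b A, monochrome b B)
  end.

Lemma color_monochrome b A k : k < G_ob A -> color (monochrome b A) k = b.
Proof.
elim: A k => //= A IHA B IHB k lt_k.
by case: ltnP => lt_kB; rewrite ?IHA ?IHB //; lia.
Qed.

Definition keep (b : bool) A := if b then A else Unit.

Fixpoint left_part A : coloring A -> obj P :=
  match A with
  | Unit => fun=> Unit
  | A ⊗ B => fun c => left_part c.1 ⊗ left_part c.2
  | X => fun b => keep b X
  end.

Fixpoint right_part A : coloring A -> obj P :=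
  match A with
  | Unit => fun=> Unit
  | A ⊗ B => fun c => right_part c.1 ⊗ right_part c.2
  | X => fun b => keep (~~ b) X
  end.

Definition place (b : bool) A : arr A (keep b A ⊗ keep (~~ b) A) :=
  if b return arr A (keep b A ⊗ keep (~~ b) A) then RUnitInv A else LUnitInv A.

(** The rearrangement of A that puts the trees of colour [true] to the left. *)
Fixpoint sift A : forall c : coloring A, arr A (left_part c ⊗ right_part c) :=
  match A with
  | Letter p => fun b => place b (Letter p)
  | Unit => fun=> LUnitInv Unit
  | A ⊗ B => fun c => interchange _ _ _ _ ∘ (sift c.1 ⊗₁ sift c.2)
  | T A => fun b => place b (T A)
  end.

Lemma sift_epi A (c : coloring A) : exists s, sift c ∘ s ≈ Id _.
Proof.
have placeP b X : exists s, place b X ∘ s ≈ Id _.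
  case: b; [exists (RUnit X); exact: runit_invl|].
  by exists (LUnit X); exact: lunit_invl.
elim: A c => [p|[]|A IHA B IHB [a b]|A _] //=.
  by exists (LUnit Unit); exact: lunit_invl.
have [s as_] := IHA a; have [t bt] := IHB b.
exists ((s ⊗₁ t) ∘ interchange _ _ _ _).
rewrite cat_assoc (pull (f := s ⊗₁ t) (h := Id _)) ?cat_idl ?interchangeK //.
by rewrite -tens_comp as_ bt tens_id.
Qed.

Lemma place_nat b A C (f : arr A C) :
  exists (f1 : arr (keep b A) (keep b C))
    (f2 : arr (keep (~~ b) A) (keep (~~ b) C)),
    place b C ∘ f ≈ (f1 ⊗₁ f2) ∘ place b A.
Proof.
case: b; first by exists f, (Id _); exact: runit_inv_nat.
by exists (Id _), f; exact: lunit_inv_nat.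
Qed.

(** For a monochrome colouring, [sift] is a unit isomorphism up to the units that
take the place of the absent trees. *)
Lemma sift_monochrome b A :
  exists (u : arr (left_part (monochrome b A)) (keep b A))
    (v : arr (right_part (monochrome b A)) (keep (~~ b) A)),
    (u ⊗₁ v) ∘ sift (monochrome b A) ≈ place b A.
Proof.
elim: A => [p||A [uA [vA eA]] B [uB [vB eB]]|A _] /=.
- by exists (Id _), (Id _); rewrite tens_id cat_idl.
- case: b; exists (Id _), (Id _); rewrite tens_id cat_idl //=.
  smc (@nil (obj P)).
- case: b => /= in uA vA eA uB vB eB *.
    exists (uA ⊗₁ uB), (LUnit Unit ∘ (vA ⊗₁ vB)).
    rewrite -(cat_idl (uA ⊗₁ uB)) tens_comp !cat_assoc.
    rewrite -(cat_assoc (_ ⊗₁ (vA ⊗₁ vB))).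
    rewrite -interchange_nat cat_assoc -tens_comp eA eB.
    by rewrite interchangeE swapE; smc [:: A; B].
  exists (LUnit Unit ∘ (uA ⊗₁ uB)), (vA ⊗₁ vB).
  rewrite -(cat_idl (vA ⊗₁ vB)) tens_comp !cat_assoc.
  rewrite -(cat_assoc (_ ⊗₁ (vA ⊗₁ vB))).
  rewrite -interchange_nat cat_assoc -tens_comp eA eB.
  by rewrite interchangeE swapE; smc [:: A; B].
- by exists (Id _), (Id _); rewrite tens_id cat_idl.
Qed.

(** Naturality of [sift], in a form that passes to composites: the colouring of the
source is obtained from that of the target. *)
Definition sifts A C (h : arr A C) : Prop :=
  forall c : coloring C, exists (c' : coloring A)
    (h1 : arr (left_part c') (left_part c))
    (h2 : arr (right_part c') (right_part c)),
    (forall k, k < G_ob A -> color c' k = color c (G_nat h k)) /\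
    sift c ∘ h ≈ (h1 ⊗₁ h2) ∘ sift c'.

Lemma sifts_eq A C (f g : arr A C) : f ≈ g -> sifts f -> sifts g.
Proof.
move=> fg sf c; have [c' [h1 [h2 [cE fE]]]] := sf c; exists c', h1, h2.
split=> [k lt_k|]; last by rewrite -fg.
by rewrite cE // (G_nat_eq fg).
Qed.

Lemma sifts_comp A B C (g : arr B C) (f : arr A B) :
  sifts g -> sifts f -> sifts (g ∘ f).
Proof.
move=> sg sf c; have [c1 [g1 [g2 [cE1 gE]]]] := sg c.
have [c2 [f1 [f2 [cE2 fE]]]] := sf c1; exists c2, (g1 ∘ f1), (g2 ∘ f2).
split=> [k lt_k|]; first by rewrite cE2 // cE1 ?G_nat_lt.
by rewrite -cat_assoc gE cat_assoc fE tens_comp cat_assoc.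
Qed.

Lemma sifts_tens A A' B B' (f : arr A A') (g : arr B B') :
  sifts f -> sifts g -> sifts (f ⊗₁ g).
Proof.
move=> sf sg [a b]; have [a' [f1 [f2 [aE fE]]]] := sf a.
have [b' [g1 [g2 [bE gE]]]] := sg b.
exists (a', b'), (f1 ⊗₁ g1), (f2 ⊗₁ g2); split=> [k /= lt_k|].
  case: ltnP => lt_kB; first by rewrite G_nat_lt // bE.
  by rewrite ltnNge leq_addr addKn aE //; lia.
by rewrite /= cat_assoc -tens_comp fE gE tens_comp -!cat_assoc interchange_nat.
Qed.

Lemma sifts_T A B (f : arr A B) : sifts (T₁ f).
Proof.
move=> b; have [h1 [h2 hE]] := place_nat b (T₁ f).
by exists b, h1, h2; split.
Qed.

Lemma sifts_assoc A B C : sifts (Assoc A B C).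
Proof.
move=> [a [b c]]; exists ((a, b), c), (Assoc _ _ _), (Assoc _ _ _).
split=> [k /= lt_k|]; first by split_ifs; rewrite ?subnDA //; lia.
rewrite /= -[in sift a](cat_idl (sift a)) tens_comp !cat_assoc -assoc_nat.
rewrite -!cat_assoc interchange_assoc !cat_assoc -tens_comp !cat_idl.
exact: eqarr_refl.
Qed.

Lemma sift_lunit A (c : coloring A) :
  sift c ∘ LUnit A
  ≈ (LUnit _ ⊗₁ LUnit _) ∘ sift ((tt, c) : coloring (Unit ⊗ A)).
Proof.
rewrite /= -lunit_nat -interchange_lunit !cat_assoc -tens_comp.
by rewrite cat_idl cat_idr.
Qed.

Lemma sifts_lunit A : sifts (LUnit A).
Proof.
move=> c; exists (tt, c), (LUnit _), (LUnit _); split=> [k /= lt_k|].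
  by rewrite addn0 in lt_k; rewrite lt_k.
exact: sift_lunit.
Qed.

Lemma sifts_lunit_inv A : sifts (LUnitInv A).
Proof.
move=> [[] c]; exists c, (LUnitInv _), (LUnitInv _); split=> [k /= lt_k|].
  by rewrite lt_k.
apply: (epi_cancel (lunit_invr A)).
rewrite cat_assoc lunit_invl cat_idr cat_assoc sift_lunit -cat_assoc.
by rewrite -tens_comp !lunit_invl tens_id cat_idl.
Qed.

Lemma sifts_braid A B : sifts (Braid A B).
Proof.
move=> [b a]; exists (a, b), (Braid _ _), (Braid _ _); split=> [k /= lt_k|].
  case: ltnP => lt_kB; first by rewrite ltnNge leq_addr addKn.
  by rewrite ifT //; lia.
by rewrite /= cat_assoc -braid_nat -cat_assoc interchange_braid cat_assoc.
Qed.

(** The target is a single tree, so the pulled back colouring is monochrome. *)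
Lemma sifts_eta A : sifts (η A).
Proof.
move=> b; have [h1 [h2 hE]] := place_nat b (η A).
have [u [v uvE]] := sift_monochrome b A.
exists (monochrome b A), (h1 ∘ u), (h2 ∘ v); split=> [k lt_k|].
  by rewrite color_monochrome.
by rewrite tens_comp cat_assoc uvE -hE.
Qed.

Lemma sifts_mu A : sifts (μ A).
Proof.
move=> b; have [h1 [h2 hE]] := place_nat b (μ A).
by exists b, h1, h2; split.
Qed.

Lemma sifts_psiL A B : sifts (ψL A B).
Proof.
move=> b; have [h1 [h2 hE]] := place_nat b (ψL A B).
have [u [v uvE]] := sift_monochrome b (T A ⊗ B).
exists (monochrome b (T A ⊗ B)), (h1 ∘ u), (h2 ∘ v); split=> [k lt_k|].
  by rewrite color_monochrome.
by rewrite tens_comp cat_assoc uvE -hE.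
Qed.

Theorem all_sift A C (h : arr A C) : sifts h.
Proof.
move: A C h; apply: (@arr_ind_generators P (@sifts)).
- by move=> A B f g; apply: sifts_eq.
- move=> A c; exists c, (Id _), (Id _); split=> //.
  by rewrite tens_id cat_idl cat_idr.
- by move=> A B C g f; apply: sifts_comp.
- by move=> A A' B B' f g; apply: sifts_tens.
- by move=> A B f _; apply: sifts_T.
- exact: sifts_assoc.
- exact: sifts_lunit.
- exact: sifts_lunit_inv.
- exact: sifts_braid.
- exact: sifts_eta.
- exact: sifts_mu.
- exact: sifts_psiL.
Qed.

(** Naturality of [sift] for the colouring of [B ⊗ C] that separates B from C. *)
Corollary tensor_decomposition A B C (f : arr A (B ⊗ C)) :
  exists (c : coloring A) (f1 : arr (left_part c) B)
    (f2 : arr (right_part c) C),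
    (forall k, k < G_ob A -> color c k = (G_ob C <= G_nat f k)) /\
    f ≈ (f1 ⊗₁ f2) ∘ sift c.
Proof.
have [u1 [v1 E1]] := sift_monochrome true B.
have [u2 [v2 E2]] := sift_monochrome false C.
have [c [h1 [h2 [cE fE]]]] :=
  all_sift f ((monochrome true B, monochrome false C) : coloring (B ⊗ C)).
exists c, (RUnit B ∘ (u1 ⊗₁ u2) ∘ h1), (LUnit C ∘ (v1 ⊗₁ v2) ∘ h2); split.
  move=> k lt_k; rewrite cE //=; have := G_nat_lt f lt_k; rewrite /= => lt_fk.
  by case: ltnP => lt_C; rewrite color_monochrome //; lia.
rewrite tens_comp cat_assoc -fE -cat_assoc /= tens_comp.
rewrite -(cat_assoc (_ ∘ _)) (push (eqarr_sym (interchange_nat _ _ _ _))).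
rewrite !cat_assoc (pull (f := sift _ ⊗₁ _) (eqarr_sym (tens_comp _ _ _ _))).
rewrite E1 E2 /=.
rewrite -!cat_assoc.
rewrite -[X in X ≈ _](cat_idl f); apply: eqarr_comp => //.
by rewrite interchangeE swapE; smc [:: B; C].
Qed.

End Splitting.

(** * The multiplication of a commutative monad *)

Section Merging.
Variable P : Type.
Implicit Types A B C D X Y : obj P.

(** Locked for the same reason as [swap]. *)
Definition merge A B : arr (T A ⊗ T B) (T (A ⊗ B)) :=
  locked (μ (A ⊗ B) ∘ T₁ (ψR A B) ∘ ψL A (T B)).

Lemma mergeE A B : merge A B = μ (A ⊗ B) ∘ T₁ (ψR A B) ∘ ψL A (T B).
Proof. by rewrite /merge -lock. Qed.

Lemma merge_nat A A' B B' (f : arr A A') (g : arr B B') :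
  merge A' B' ∘ (T₁ f ⊗₁ T₁ g) ≈ T₁ (f ⊗₁ g) ∘ merge A B.
Proof.
rewrite !mergeE !cat_assoc psiL_nat (pull (eqarr_sym (T_comp _ _))) psiR_nat.
by rewrite T_comp -!cat_assoc mu_nat.
Qed.

Lemma merge_eta_l A B : merge A B ∘ (η A ⊗₁ Id (T B)) ≈ ψR A B.
Proof.
by rewrite mergeE !cat_assoc psiL_eta -eta_nat -cat_assoc mu_etaT cat_idl.
Qed.

Lemma merge_eta A B : merge A B ∘ (η A ⊗₁ η B) ≈ η (A ⊗ B).
Proof. by rewrite -tens_lr -cat_assoc merge_eta_l psiR_eta. Qed.

Lemma merge_mu_l A B :
  merge A B ∘ (μ A ⊗₁ Id (T B))
  ≈ μ (A ⊗ B) ∘ T₁ (merge A B) ∘ ψL (T A) (T B).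
Proof.
rewrite !mergeE !cat_assoc psiL_mu !T_comp !cat_assoc.
rewrite -(cat_assoc (T₁ (ψR _ _))) -mu_nat -!cat_assoc.
by rewrite mu_assoc.
Qed.

Lemma merge_braid A B :
  T₁ (Braid A B) ∘ merge A B ≈ merge B A ∘ Braid (T A) (T B).
Proof.
have psiR_braided X Y : T₁ (Braid X Y) ∘ ψR X Y ≈ ψL Y X ∘ Braid X (T Y).
  by rewrite psiR_braid !cat_assoc -2!cat_assoc -T_comp braid_inv T_id cat_idl.
rewrite [merge A B]mergeE !cat_assoc -(cat_assoc (T₁ _)) -mu_nat cat_assoc.
rewrite (pull (eqarr_sym (T_comp _ _))) psiR_braided T_comp cat_assoc.
by rewrite psi_braid -!cat_assoc psiLR_mu mergeE.
Qed.

Lemma merge_psiR A B C :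
  T₁ (Assoc A B C) ∘ merge (A ⊗ B) C ∘ (ψR A B ⊗₁ Id (T C))
  ≈ ψR A (B ⊗ C) ∘ (Id A ⊗₁ merge B C) ∘ Assoc A (T B) (T C).
Proof.
rewrite !mergeE -!cat_assoc -mu_nat (push (eqarr_sym (T_comp _ _))).
rewrite psiR_assoc !T_comp !cat_assoc -(cat_assoc (T₁ (Assoc _ _ _))) psiRL_assoc.
rewrite !tens_compr -!cat_assoc psiR_mu.
by rewrite (push (psiR_nat _ _)) -!cat_assoc.
Qed.

(** The first factor is brought out by [merge_mu_l], which reduces the equation to
the associativity of [ψL] and to [merge_psiR], where the first factor is not
under T. *)
Lemma merge_assoc A B C :
  T₁ (Assoc A B C) ∘ merge (A ⊗ B) C ∘ (merge A B ⊗₁ Id (T C))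
  ≈ merge A (B ⊗ C) ∘ (Id (T A) ⊗₁ merge B C) ∘ Assoc (T A) (T B) (T C).
Proof.
rewrite [merge A B]mergeE !tens_compl -!cat_assoc.
rewrite (push (merge_mu_l _ _)) -!cat_assoc -mu_nat.
rewrite (push (psiL_nat _ _)) -!cat_assoc.
rewrite (push (eqarr_sym (T_comp _ _))) (push (eqarr_sym (T_comp _ _))).
rewrite -cat_assoc merge_psiR !T_comp !cat_assoc.
rewrite -(cat_assoc (T₁ (Assoc _ _ _))) psiL_assoc.
rewrite [merge A (B ⊗ C)]mergeE -T_id !cat_assoc.
by rewrite (pull (psiL_nat _ _)) !cat_assoc.
Qed.

Lemma G_merge_r A B k : k < G_ob B -> G_nat (merge A B) k = k.
Proof. by move=> lt_k; rewrite mergeE /=; split_ifs; lia. Qed.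

Lemma G_merge_l A B k :
  k < G_ob A -> G_nat (merge A B) ((G_ob B).+1 + k) = G_ob B + k.
Proof. by move=> lt_k; rewrite mergeE /=; split_ifs; lia. Qed.

End Merging.

(** * Arrows into T B *)

Section Flattening.
Variable P : Type.
Implicit Types A B C D X Y : obj P.

(** A set of occurrences of T closed under passing to an enclosing T: an
occurrence is either marked, together with some of those inside it, or unmarked
with everything inside it. *)
Fixpoint marking A : Type :=
  match A with
  | Letter _ | Unit => unit
  | A ⊗ B => marking A * marking B
  | T A => option (marking A)
  end.

Fixpoint marked A : marking A -> nat -> bool :=
  match A with
  | Letter _ | Unit => fun _ _ => false
  | A ⊗ B => fun m k =>
      if k < G_ob B then marked m.2 k else marked m.1 (k - G_ob B)
  | T A => fun m k =>
      if m is Some m' then if k < G_ob A then marked m' k else true else false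
  end.

Lemma marked_inj A (m m' : marking A) :
  (forall k, k < G_ob A -> marked m k = marked m' k) -> m = m'.
Proof.
elim: A m m' => [p [] []|[] []|A IHA B IHB [a b] [a' b']|A IHA m m'] //= mm'.
  congr pair.
    apply: IHA => k lt_k; have := mm' (G_ob B + k); rewrite ltn_add2l lt_k.
    by rewrite ltnNge leq_addr addKn; apply.
  by apply: IHB => k lt_k; have := mm' k; rewrite lt_k ltn_addr //; apply.
have := mm' (G_ob A) (ltnSn _); rewrite ltnn.
case: m m' mm' => [m|] [m'|] //= mm' _; congr Some; apply: IHA => k lt_k.
by have := mm' k (ltnW lt_k); rewrite lt_k.
Qed.

Fixpoint unmarked A : marking A :=
  match A with
  | Letter _ | Unit => tt
  | A ⊗ B => (unmarked A, unmarked B)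
  | T A => None
  end.

Lemma marked_unmarked A k : marked (unmarked A) k = false.
Proof. by elim: A k => //= A IHA B IHB k; case: ifP. Qed.

(** The object left when the marked occurrences of T are deleted. *)
Fixpoint strip A : marking A -> obj P :=
  match A with
  | A ⊗ B => fun m => strip m.1 ⊗ strip m.2
  | T A => fun m => if m is Some m' then strip m' else T A
  | X => fun=> X
  end.

(** All the marked occurrences of T are merged into one outermost T, which is
created by [η] where nothing is marked. *)
Fixpoint flatten A : forall m : marking A, arr A (T (strip m)) :=
  match A with
  | Letter p => fun=> η (Letter p)
  | Unit => fun=> η Unit
  | A ⊗ B => fun m => merge _ _ ∘ (flatten m.1 ⊗₁ flatten m.2)
  | T A => fun m =>
      match m return arr (T A) (T (strip (m : marking (T A)))) with
      | Some m' => μ _ ∘ T₁ (flatten m')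
      | None => η (T A)
      end
  end.

(** Nothing is deleted from A: [w] is an identity, but the equality of objects that
would make it one holds by induction only, not by computation. *)
Lemma flatten_unmarked A :
  exists w : arr (strip (unmarked A)) A, T₁ w ∘ flatten (unmarked A) ≈ η A.
Proof.
elim: A => [p||A [u uE] B [v vE]|A _] /=.
- by exists (Id _); rewrite T_id cat_idl.
- by exists (Id _); rewrite T_id cat_idl.
- exists (u ⊗₁ v); rewrite -cat_assoc -merge_nat cat_assoc -tens_comp uE vE.
  exact: merge_eta.
- by exists (Id _); rewrite T_id cat_idl.
Qed.

(** [flatten m] is not invertible, but every element outside the outermost T of its
target is reached; hence [T₁ f' ∘ flatten m] still determines the graph of
[f']. *)
Lemma flatten_onto A (m : marking A) i :
  i < G_ob (strip m) -> exists2 k, k < G_ob A & G_nat (flatten m) k = i.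
Proof.
elim: A m i => [p|[]|A IHA B IHB [a b]|A IHA [m|]] //=.
- by move=> _ i lt_i; exists i.
- move=> i lt_i; case: (ltnP i (G_ob (strip b))) => lt_ib.
    have [k lt_k kE] := IHB b i lt_ib; exists k; first exact: ltn_addr.
    by rewrite lt_k kE G_merge_r.
  have lt_ia : i - G_ob (strip b) < G_ob (strip a) by lia.
  have [k lt_k kE] := IHA a _ lt_ia.
  exists (G_ob B + k); first by rewrite ltn_add2l.
  by rewrite ltnNge leq_addr addKn kE (G_merge_l _ lt_ia) subnKC.
- move=> i lt_i; have [k lt_k kE] := IHA m i lt_i; exists k; first exact: ltnW.
  by rewrite lt_k kE ltnS (ltnW lt_i).
- by move=> i lt_i; exists i.
Qed.

(** The analogue of [sifts] for markings. *)
Definition flattens A C (h : arr A C) : Prop :=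
  forall m : marking C, exists (m' : marking A) (h' : arr (strip m') (strip m)),
    (forall k, k < G_ob A -> marked m' k = marked m (G_nat h k)) /\
    flatten m ∘ h ≈ T₁ h' ∘ flatten m'.

Lemma flattens_eq A C (f g : arr A C) : f ≈ g -> flattens f -> flattens g.
Proof.
move=> fg sf m; have [m' [h [mE fE]]] := sf m; exists m', h.
split=> [k lt_k|]; last by rewrite -fg.
by rewrite mE // (G_nat_eq fg).
Qed.

Lemma flattens_comp A B C (g : arr B C) (f : arr A B) :
  flattens g -> flattens f -> flattens (g ∘ f).
Proof.
move=> sg sf m; have [m1 [g' [mE1 gE]]] := sg m.
have [m2 [f' [mE2 fE]]] := sf m1; exists m2, (g' ∘ f').
split=> [k lt_k|]; first by rewrite mE2 // mE1 ?G_nat_lt.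
by rewrite -cat_assoc gE cat_assoc fE T_comp cat_assoc.
Qed.

Lemma flattens_tens A A' B B' (f : arr A A') (g : arr B B') :
  flattens f -> flattens g -> flattens (f ⊗₁ g).
Proof.
move=> sf sg [a b]; have [a' [f' [aE fE]]] := sf a.
have [b' [g' [bE gE]]] := sg b.
exists (a', b'), (f' ⊗₁ g'); split=> [k /= lt_k|].
  case: ltnP => lt_kB; first by rewrite G_nat_lt // bE.
  by rewrite ltnNge leq_addr addKn aE //; lia.
by rewrite /= cat_assoc -tens_comp fE gE tens_comp -!cat_assoc merge_nat.
Qed.

Lemma flattens_T A B (f : arr A B) : flattens f -> flattens (T₁ f).
Proof.
move=> sf [m|]; last first.
  exists None, (T₁ f); split=> [//|]; exact: eta_nat.
have [m' [f' [mE fE]]] := sf m; exists (Some m'), f'; split=> [k /= lt_k|].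
  by case: ifP => lt_kA; rewrite ?ltnn // G_nat_lt ?mE.
by rewrite /= cat_assoc -T_comp fE T_comp -!cat_assoc mu_nat.
Qed.

Lemma flattens_assoc A B C : flattens (Assoc A B C).
Proof.
move=> [a [b c]]; exists ((a, b), c), (Assoc _ _ _).
split=> [k /= lt_k|]; first by split_ifs; rewrite ?subnDA //; lia.
rewrite /= -[X in merge _ _ ∘ (X ⊗₁ _) ∘ _]cat_idl tens_comp.
rewrite -[flatten c in X in _ ≈ X]cat_idl tens_comp.
rewrite -!cat_assoc merge_assoc !cat_assoc -assoc_nat.
exact: eqarr_refl.
Qed.

Lemma flatten_lunit A (m : marking A) :
  flatten m ∘ LUnit A ≈ T₁ (LUnit _) ∘ flatten ((tt, m) : marking (Unit ⊗ A)).
Proof.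
rewrite /= -lunit_nat -(tens_lr (η _)) -!cat_assoc (push (merge_eta_l _ _)).
by rewrite psiR_unit.
Qed.

Lemma flattens_lunit A : flattens (LUnit A).
Proof.
move=> m; exists (tt, m), (LUnit _); split=> [k /= lt_k|].
  by rewrite addn0 in lt_k; rewrite lt_k.
exact: flatten_lunit.
Qed.

Lemma flattens_lunit_inv A : flattens (LUnitInv A).
Proof.
move=> [[] m]; exists m, (LUnitInv _); split=> [k /= lt_k|].
  by rewrite lt_k.
apply: (epi_cancel (lunit_invr A)).
rewrite cat_assoc lunit_invl cat_idr cat_assoc flatten_lunit -cat_assoc.
by rewrite -T_comp lunit_invl T_id cat_idl.
Qed.

Lemma flattens_braid A B : flattens (Braid A B).
Proof.
move=> [b a]; exists (a, b), (Braid _ _); split=> [k /= lt_k|].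
  case: ltnP => lt_kB; first by rewrite ltnNge leq_addr addKn.
  by rewrite ifT //; lia.
by rewrite /= cat_assoc -braid_nat -!cat_assoc merge_braid.
Qed.

Lemma flattens_eta A : flattens (η A).
Proof.
move=> [m|]; last first.
  have [w wE] := flatten_unmarked A.
  exists (unmarked A), (η A ∘ w); split=> [k _|]; first exact: marked_unmarked.
  by rewrite T_comp cat_assoc wE /= eta_nat.
exists m, (Id _); split=> [k /= -> //|].
by rewrite /= cat_assoc -eta_nat -cat_assoc mu_etaT T_id.
Qed.

Lemma flattens_mu A : flattens (μ A).
Proof.
move=> [m|]; last first.
  exists None, (μ A); split=> [//|]; exact: eta_nat.
exists (Some (Some m)), (Id _); split=> [k /= lt_k|].
  by split_ifs; rewrite ?ltnn //; lia.
rewrite /= T_id cat_idl T_comp -cat_assoc mu_assoc !cat_assoc.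
by rewrite mu_nat.
Qed.

Lemma flattens_psiL A B : flattens (ψL A B).
Proof.
move=> [[a b]|]; last first.
  have [w wE] := flatten_unmarked B.
  exists (None, unmarked B), (ψL A B ∘ (Id _ ⊗₁ w)); split=> [k /= lt_k|].
    by case: ifP => // _; apply: marked_unmarked.
  rewrite /= T_comp cat_assoc -(cat_assoc (T₁ (Id _ ⊗₁ _))) -merge_nat cat_assoc.
  by rewrite -tens_comp wE T_id cat_idl merge_eta eta_nat.
exists (Some a, b), (Id _); split=> [k /= lt_k|].
  by split_ifs => //; lia.
rewrite /= T_id cat_idl -[flatten b in X in _ ≈ X]cat_idl tens_comp.
rewrite -cat_assoc merge_mu_l !cat_assoc psiL_nat T_comp !cat_assoc.
exact: eqarr_refl.
Qed.

Theorem all_flatten A C (h : arr A C) : flattens h.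
Proof.
move: A C h; apply: (@arr_ind_generators P (@flattens)).
- by move=> A B f g; apply: flattens_eq.
- move=> A m; exists m, (Id _); split=> //.
  by rewrite T_id cat_idl cat_idr.
- by move=> A B C g f; apply: flattens_comp.
- by move=> A A' B B' f g; apply: flattens_tens.
- by move=> A B f; apply: flattens_T.
- exact: flattens_assoc.
- exact: flattens_lunit.
- exact: flattens_lunit_inv.
- exact: flattens_braid.
- exact: flattens_eta.
- exact: flattens_mu.
- exact: flattens_psiL.
Qed.

(** Naturality of [flatten] for the marking of [T B] at the outermost T only. *)
Corollary T_decomposition A B (f : arr A (T B)) :
  exists (m : marking A) (f' : arr (strip m) B),
    (forall k, k < G_ob A -> marked m k = (G_ob B <= G_nat f k)) /\
    f ≈ T₁ f' ∘ flatten m.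
Proof.
have [w wE] := flatten_unmarked B.
have [m [h [mE fE]]] := all_flatten f (Some (unmarked B) : marking (T B)).
exists m, (w ∘ h); split=> [k lt_k|].
  by rewrite mE //= marked_unmarked; case: ltnP.
rewrite T_comp cat_assoc -fE -cat_assoc /= -cat_assoc -mu_nat.
by rewrite (push (eqarr_sym (T_comp _ _))) wE mu_Teta cat_idl.
Qed.

End Flattening.

(** * Faithfulness *)

Theorem graph_faithful (P : Type) (A B : obj P) (f g : arr A B) :
  same_graph f g -> f ≈ g.
Proof.
elim: B => [p||B IHB C IHC|B IHB] in A f g * => fg.
- exact: T_free_coherence.
- exact: T_free_coherence.
- have [c [f1 [f2 [cE fE]]]] := tensor_decomposition f.
  have [c' [g1 [g2 [cE' gE]]]] := tensor_decomposition g.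
  have cc' : c' = c by apply: color_inj => k lt_k; rewrite cE' // cE // fg.
  rewrite {}cc' in g1 g2 cE' gE.
  have [s sK] := sift_epi c.
  have [fg1 fg2] := same_graph_tens (same_graph_cancel sK fE gE fg).
  by rewrite fE gE (IHB _ _ _ fg1) (IHC _ _ _ fg2).
- have [m [f' [mE fE]]] := T_decomposition f.
  have [m' [g' [mE' gE]]] := T_decomposition g.
  have mm' : m' = m by apply: marked_inj => k lt_k; rewrite mE' // mE // fg.
  rewrite {}mm' in g' mE' gE.
  rewrite fE gE (IHB _ f' g') // => i lt_i.
  have [k lt_k kE] := flatten_onto lt_i; have := fg k lt_k.
  by rewrite (G_nat_eq fE) // (G_nat_eq gE) //= kE lt_i.
Qed.

Theorem mainTheorem4 (P : Type) : faithful (G P).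
Proof.
move=> A B f g fg; apply: graph_faithful => k lt_k.
have {}fg : G_arr f =1 G_arr g := fg.
by rewrite -(G_natE f (Ordinal lt_k)) -(G_natE g (Ordinal lt_k)) fg.
Qed.
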